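(* Identify the monic real polynomial $Q_d=x^d+\sum_{j=0}^{d-1}a_jx^j$ with the point $(a_0,\ldots,a_{d-1})\in\mathbb{R}^d$, so that all the sets of polynomials below are subsets of $\mathbb{R}^d$. (1) For $d$ even and for each $d$-tuple $\sigma=(\sigma_0,\ldots,\sigma_{d-1})\in\{+,-\}^d$ with $\sigma_0=+$, the subset $\mathcal{E}_d(\sigma)\subset\mathcal{E}_d$ is non-empty and convex, hence contractible. (2) For $d$ odd and for each $d$-tuple $\sigma\in\{+,-\}^d$, the set $\mathcal{F}_d(\sigma)$ is non-empty and contractible. (3) For $d$ even and for each $d$-tuple $\sigma\in\{+,-\}^d$ with $\sigma_0=-$ (i.e. $a_0<0$), the set $\mathcal{G}_{d,(1,1)}(\sigma)$ is contractible. For $d$ even and for each $d$-tuple $\sigma\in\{+,-\}^d$ with $\sigma_0=+$ (i.e. $a_0>0$), each set $\mathcal{G}_{d,(2,0)}(\sigma)$ (resp. $\mathcal{G}_{d,(0,2)}(\sigma)$) is contractible or empty. It is empty exactly in Case 1) (resp. in Case 2)).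
   Context: For $\sigma=(\sigma_0,\ldots,\sigma_{d-1})\in\{+,-\}^d$, a polynomial $Q_d=x^d+\sum_{j=0}^{d-1}a_jx^j$ with real coefficients has signs of the coefficients defined by $\sigma$ if all $a_j$ are non-zero and $\mathrm{sign}(a_j)=\sigma_j$ for $j=0,\ldots,d-1$. For $d$ even, $\mathcal{E}_d$ is the set of elliptic polynomials, i.e. monic real degree $d$ polynomials with no real roots (for these one has $a_0>0$). The following sets consist of monic real degree $d$ polynomials with signs of the coefficients defined by $\sigma$: - $\mathcal{E}_d(\sigma)$ ($d$ even): those belonging to $\mathcal{E}_d$. - $\mathcal{F}_d(\sigma)$ ($d$ odd): those with exactly one real root, this root being simple. - $\mathcal{G}_d(\sigma)$ ($d$ even): those with exactly two real roots, both simple. - $\mathcal{G}_{d,(1,1)}(\sigma)$ ($d$ even, $\sigma_0=-$): equal to $\mathcal{G}_d(\sigma)$ (the two real roots then have opposite signs). - $\mathcal{G}_{d,(2,0)}(\sigma)$, resp. $\mathcal{G}_{d,(0,2)}(\sigma)$ ($d$ even, $\sigma_0=+$): those polynomials of $\mathcal{G}_d(\sigma)$ which have two positive, resp. two negative, distinct roots and no other real roots. For $d$ even, two special cases are defined according to the signs of the coefficients of $Q_d$ and the numbers of its positive and negative roots: Case 1): the constant term and all coefficients of monomials of odd degrees are positive, there is at least one coefficient of even degree which is negative, and $Q_d$ is required to have 2 positive and no negative roots (so this case concerns $\mathcal{G}_{d,(2,0)}(\sigma)$). Case 2): the constant term is positive, all coefficients of monomials of odd degrees are negative, there is at least one coefficient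 of even degree which is negative, and $Q_d$ is required to have 2 negative and no positive roots (so this case concerns $\mathcal{G}_{d,(0,2)}(\sigma)$).
   Formalization: The emptiness criterion is corrected: the (2,0) set is empty exactly in Case 1) or when all signs are +, and the (0,2) set exactly in Case 2) or when σ_j = (−1)^j for all j; as printed it fails, e.g. for x²+a₁x+a₀ with a₀, a₁ > 0, which has no positive roots. *)

(* Defs.v *)
From HB Require Import structures.
From mathcomp Require Import all_boot all_order all_algebra.
From mathcomp Require Import all_classical all_reals all_analysis.

Set Implicit Arguments.
Unset Strict Implicit.
Unset Printing Implicit Defensive.

Import Order.TTheory GRing.Theory Num.Theory.
Import numFieldNormedType.Exports.

Local Open Scope classical_set_scope.
Local Open Scope ring_scope.

(* The identity of the subspace A is homotopic, within A, to a constant map;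
   in particular A is non-empty. R only provides the parameter interval. *)
Definition contractible (R : realType) (T : topologicalType) (A : set T) :=
  exists x0 : T, A x0 /\
  exists H : T * R -> T,
    [/\ {within A `*` `[0, 1], continuous H},
        (forall x t, A x -> 0 <= t <= 1 -> A (H (x, t))),
        (forall x, A x -> H (x, 0) = x) &
        (forall x, A x -> H (x, 1) = x0)].

Inductive csign := Plus | Minus.

Definition csign_val (R : realType) (s : csign) : R :=
  if s is Plus then 1 else -1.

(* The point (a_0, ..., a_{d-1}) stands for x^d + \sum_(j < d) a_j x^j. *)
Definition Qpoly (R : realType) (d : nat) (a : 'rV[R]_d) : {poly R} :=
  'X^d + \sum_(j < d) a 0 j *: 'X^j.

(* As csign_val is 1 or -1, this forces all the coefficients to be non-zero. *)
Definition has_signs (R : realType) (d : nat) (sigma : 'I_d -> csign)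
    (a : 'rV[R]_d) :=
  forall j : 'I_d, Num.sg (a 0 j) = csign_val R (sigma j).

Definition elliptic (R : realType) (d : nat) : set 'rV[R]_d :=
  [set a | forall x : R, ~ root (Qpoly a) x].

Definition Eset (R : realType) (d : nat) (sigma : 'I_d -> csign) :
    set 'rV[R]_d :=
  [set a | elliptic a /\ has_signs sigma a].

Definition Fset (R : realType) (d : nat) (sigma : 'I_d -> csign) :
    set 'rV[R]_d :=
  [set a | has_signs sigma a /\
     exists x : R,
       (forall z, root (Qpoly a) z <-> z = x) /\ mup x (Qpoly a) = 1%N].

Definition Gset (R : realType) (d : nat) (sigma : 'I_d -> csign) :
    set 'rV[R]_d :=
  [set a | has_signs sigma a /\
     exists x y : R,
       [/\ x <> y,
           (forall z, root (Qpoly a) z <-> z = x \/ z = y),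
           mup x (Qpoly a) = 1%N & mup y (Qpoly a) = 1%N]].

(* Only used when the constant term is negative: the two real roots of an
   even degree polynomial then automatically have opposite signs. *)
Definition Gset11 (R : realType) (d : nat) (sigma : 'I_d -> csign) :
    set 'rV[R]_d := Gset sigma.

Definition Gset20 (R : realType) (d : nat) (sigma : 'I_d -> csign) :
    set 'rV[R]_d :=
  [set a | Gset sigma a /\ forall z : R, root (Qpoly a) z -> 0 < z].

Definition Gset02 (R : realType) (d : nat) (sigma : 'I_d -> csign) :
    set 'rV[R]_d :=
  [set a | Gset sigma a /\ forall z : R, root (Qpoly a) z -> z < 0].

Definition case1 (d : nat) (sigma : 'I_d -> csign) :=
  [/\ (forall j : 'I_d, j = 0%N :> nat -> sigma j = Plus),
      (forall j : 'I_d, odd j -> sigma j = Plus) &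
      (exists j : 'I_d, ~~ odd j /\ sigma j = Minus)].

Definition case2 (d : nat) (sigma : 'I_d -> csign) :=
  [/\ (forall j : 'I_d, j = 0%N :> nat -> sigma j = Plus),
      (forall j : 'I_d, odd j -> sigma j = Minus) &
      (exists j : 'I_d, ~~ odd j /\ sigma j = Minus)].

(* The sign sequences of Q(x), resp. for even d of Q(-x), without any sign
   change (the leading coefficient is 1): Descartes' rule excludes positive,
   resp. negative, roots. *)
Definition no_sign_change (d : nat) (sigma : 'I_d -> csign) :=
  forall j : 'I_d, sigma j = Plus.

Definition no_sign_preservation (d : nat) (sigma : 'I_d -> csign) :=
  forall j : 'I_d, sigma j = if odd j then Minus else Plus.

(* Main.v *)
Require Import Defs.
From HB Require Import structures.
From mathcomp Require Import all_boot all_order all_algebra.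
From mathcomp Require Import all_classical all_reals all_analysis.
From mathcomp Require Import zify ring lra.

Set Implicit Arguments.
Unset Strict Implicit.
Unset Printing Implicit Defensive.

Import Order.TTheory GRing.Theory Num.Theory.
Import numFieldNormedType.Exports.

Local Open Scope classical_set_scope.
Local Open Scope ring_scope.

(** Fix the real roots of the polynomial. The monic polynomials Q = D * P with
    P positive on the whole line and D a fixed product of linear factors form a
    convex set, and so do those whose coefficients have prescribed signs: a
    convex combination of two of them is D times a convex combination of two
    positive polynomials ([fiber_conv]). All the sets of the theorem are unions
    of such convex fibers: D = 1 for elliptic polynomials, D = X - u for one
    simple root, D = (X - u)(X - v) for two simple roots.

    The substitution x -> x / r, which multiplies the coefficient of x^j by
    r^(d - j) and hence keeps all the signs, brings the root of the case of odd
    degree to 1 or -1, and the larger of two roots to 1 (it is positive in the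
    cases considered). What remains is a single parameter w = v / u, which
    ranges over an interval B, and over each w a convex fiber. If there is a
    continuous section w |-> s(w) of the fibers over B, the set is contracted by
    moving a point linearly to s(w) inside its fiber and then moving w along B,
    while the scale r goes to 1 ([contractible_fibration]). The roots of Q depend
    continuously on Q because they are located by the signs of Q at finitely
    many points ([cvg_simple_root], [cvg_two_roots]).

    The section starts from the trinomials x^d - 1 - phi(w) (x^m - 1) with m odd,
    which vanish at 1, and also at w when phi(w) = (w^d - 1) / (w^m - 1). For d
    even they have no other real root, because (x^d - 1) / (x^m - 1) is a strictly
    increasing function of x; [crossg_gt0] is an algebraic form of this fact
    that also covers the coincidence x = w, so that the roots are simple. A small
    perturbation that vanishes at 1 and w gives all the coefficients their
    signs. It has to be small continuously in w: the admissible size is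
    measured by the infimum of P(x) / (1 + x^n), where n is the degree of P, and
    this infimum is positive and Lipschitz in the coefficients of P ([margin_gt0],
    [cvg_margin], [fiber_section]).

    It remains to find B. The difference Q(x) - Q(-x) is twice the odd part of
    Q, so if all the odd coefficients have the same sign, then at the larger
    root u one knows the sign of Q(-u), hence on which side of -1 the ratio w
    lies. When the constant term is negative, B is ]-oo, -1[ or ]-1, 0[ in these
    two situations, and ]-oo, 0[ when both signs occur among the odd
    coefficients. In the last situation one uses a trinomial with
    a negative middle coefficient for w > -1 and one with a positive middle
    coefficient for w < -1, which agree at w = -1. For two positive
    roots the same remark shows that some odd coefficient has to be negative;
    then B = ]0, 1[ and there is a section. Two negative roots reduce to
    two positive ones by x -> -x. *)

(** * Geometric sums and their divided differences *)

Section GeometricSums.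
Variable R : comNzRingType.
Implicit Types x y : R.

Definition geom n x : R := \sum_(i < n) x ^+ i.

(** The complete homogeneous sum of degree n - 1, i.e. the divided difference
    (x^n - y^n) / (x - y) as a polynomial, meaningful also for x = y. *)
Definition homg n x y : R := \sum_(i < n) x ^+ i * y ^+ (n.-1 - i).

(** The divided difference of [geom n] between x and y. *)
Definition dgeom n x y : R := \sum_(i < n) homg i x y.

Lemma geomS n x : geom n.+1 x = geom n x + x ^+ n.
Proof. by rewrite /geom big_ord_recr. Qed.

Lemma homgS n x y : homg n.+1 x y = y * homg n x y + x ^+ n.
Proof.
rewrite /homg big_ord_recr /= subnn mulr1; congr (_ + _).
rewrite big_distrr /=; apply: eq_bigr => -[i /= lt_in] _.
by rewrite mulrCA -exprS; congr (_ * _ ^+ _); lia.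
Qed.

Lemma dgeomS n x y : dgeom n.+1 x y = dgeom n x y + homg n x y.
Proof. by rewrite /dgeom big_ord_recr. Qed.

Lemma geom0 x : geom 0 x = 0. Proof. exact: big_ord0. Qed.
Lemma homg0 x y : homg 0 x y = 0. Proof. exact: big_ord0. Qed.
Lemma dgeom0 x y : dgeom 0 x y = 0. Proof. exact: big_ord0. Qed.

Lemma geomE n x : (x - 1) * geom n x = x ^+ n - 1.
Proof.
elim: n => [|n IHn]; first by rewrite geom0 mulr0 expr0 subrr.
by rewrite geomS mulrDr IHn exprS; ring.
Qed.

Lemma homgE n x y : (x - y) * homg n x y = x ^+ n - y ^+ n.
Proof.
elim: n => [|n IHn]; first by rewrite homg0 mulr0 !expr0 subrr.
by rewrite homgS mulrDr mulrCA IHn !exprS; ring.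
Qed.

Lemma dgeomE n x y : (x - y) * dgeom n x y = geom n x - geom n y.
Proof.
elim: n => [|n IHn]; first by rewrite dgeom0 !geom0 mulr0 subrr.
by rewrite dgeomS !geomS mulrDr IHn homgE; ring.
Qed.

Lemma homgD j l x y : homg (j + l) x y = y ^+ l * homg j x y + x ^+ j * homg l x y.
Proof.
elim: l => [|l IHl]; first by rewrite addn0 homg0 mulr0 addr0 mul1r.
by rewrite addnS !homgS IHl exprS exprD; ring.
Qed.

Lemma homg_cross i j x y : (j <= i)%N ->
  homg i x y * y ^+ j - y ^+ i * homg j x y = (x * y) ^+ j * homg (i - j) x y.
Proof.
move=> le_ji; rewrite -{1 2}(subnKC le_ji) homgD exprD exprMn; ring.
Qed.

Lemma homgC n x y : homg n x y = homg n y x.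
Proof.
rewrite /homg (reindex_inj rev_ord_inj) /=; apply: eq_bigr => -[i /= lt_in] _.
by rewrite mulrC; congr (_ ^+ _ * _ ^+ _); lia.
Qed.

Lemma dgeom1B n x y : (1 - x) * dgeom n x y = geom n y - homg n x y.
Proof.
elim: n => [|n IHn]; first by rewrite dgeom0 geom0 homg0 mulr0 subrr.
by rewrite dgeomS geomS mulrDr IHn (homgC n.+1) homgS homgC; ring.
Qed.

Lemma homgN n x y : homg n (- x) (- y) = (-1) ^+ n.-1 * homg n x y.
Proof.
rewrite /homg big_distrr; apply: eq_bigr => -[i /= lt_in] _.
rewrite (exprNn x) (exprNn y) mulrACA -exprD; congr (_ ^+ _ * _); lia.
Qed.

End GeometricSums.

Section Morphisms.

Lemma map_homg (A B : comNzRingType) (f : {rmorphism A -> B}) n (x y : A) :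
  f (homg n x y) = homg n (f x) (f y).
Proof.
by rewrite /homg rmorph_sum; apply: eq_bigr => i _; rewrite rmorphM !rmorphXn.
Qed.

Lemma map_geom (A B : comNzRingType) (f : {rmorphism A -> B}) n (x : A) :
  f (geom n x) = geom n (f x).
Proof. by rewrite /geom rmorph_sum; apply: eq_bigr => i _; rewrite rmorphXn. Qed.

Lemma map_dgeom (A B : comNzRingType) (f : {rmorphism A -> B}) n (x y : A) :
  f (dgeom n x y) = dgeom n (f x) (f y).
Proof. by rewrite /dgeom rmorph_sum; apply: eq_bigr => i _; rewrite map_homg. Qed.

End Morphisms.

Section Positivity.
Variable R : realFieldType.
Implicit Types x y w : R.

Lemma geom_ge1 m x : (0 < m)%N -> 0 <= x -> 1 <= geom m x.
Proof.
case: m => // m _ x0; rewrite /geom big_ord_recl expr0 lerDl.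
by apply: sumr_ge0 => i _; rewrite exprn_ge0.
Qed.

Lemma le_geom m d x : (m <= d)%N -> 0 <= x -> geom m x <= geom d x.
Proof.
move=> le_md x0; rewrite -(subnKC le_md); elim: (d - m)%N => [|l IH].
  by rewrite addn0.
by rewrite addnS geomS (le_trans IH)// lerDl exprn_ge0.
Qed.

Lemma lt_geom m d x : (m < d)%N -> 0 < x -> geom m x < geom d x.
Proof.
move=> lt_md x0; apply: lt_le_trans (le_geom lt_md (ltW x0)).
by rewrite geomS ltrDl exprn_gt0.
Qed.

Lemma exprn_odd_even_lt d m w : odd m -> ~~ odd d -> w < 0 ->
  w ^+ m < 0 < w ^+ d.
Proof.
move=> om od w0; rewrite exprn_odd_lt0// w0 /=.
by rewrite exprn_even_gt0// (lt_eqF w0) orbT.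
Qed.

(** For x < 0 both x^m - 1 and x - 1 are negative. *)
Lemma geom_odd_gt0 m x : odd m -> 0 < geom m x.
Proof.
move=> om; have [x0|x0] := leP 0 x.
  by rewrite (lt_le_trans ltr01)// geom_ge1//; case: m om.
have : (x - 1) * geom m x < 0.
  by rewrite geomE subr_lt0 (lt_trans _ ltr01)// exprn_odd_lt0.
by rewrite nmulr_rlt0// subr_lt0 (lt_trans x0).
Qed.

Lemma geom_even_lt_odd d m w : odd m -> ~~ odd d -> w < 0 ->
  geom d w < geom m w.
Proof.
move=> om od w0; have w1 : w - 1 < 0 by rewrite subr_lt0 (lt_trans w0).
rewrite -(ltr_nM2l w1) !geomE ltrD2r.
by case/andP: (exprn_odd_even_lt om od w0) => ? ?; apply: (lt_trans (y := 0)).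
Qed.

Lemma homg_ge0 n x y : 0 <= x -> 0 <= y -> 0 <= homg n x y.
Proof.
by move=> *; apply: sumr_ge0 => i _; rewrite mulr_ge0// exprn_ge0.
Qed.

Lemma homg_gt0 n x y : (0 < n)%N -> 0 <= x -> 0 < y -> 0 < homg n x y.
Proof.
case: n => // n _ x0 y0; rewrite homgC homgS.
by rewrite ltr_wpDl ?exprn_gt0 ?mulr_ge0 ?homg_ge0// ltW.
Qed.

(** Up to the factor geom m x * geom m w, this is the divided difference
    between x and w of the function geom d / geom m, that is, of
    (x^d - 1) / (x^m - 1). *)
Definition crossg d m x w : R := dgeom d x w * geom m w - geom d w * dgeom m x w.

Lemma crossgE d m x w :
  (x - w) * crossg d m x w = geom d x * geom m w - geom d w * geom m x.
Proof. by rewrite /crossg mulrBr mulrA mulrCA !dgeomE; ring. Qed.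

Lemma crossg1B d m x w :
  (1 - x) * crossg d m x w = geom d w * homg m x w - homg d x w * geom m w.
Proof. by rewrite /crossg mulrBr mulrA mulrCA !dgeom1B; ring. Qed.

(** Writing geom d and dgeom d as sums over i < d, the terms with i < m
    cancel, and those with i >= m split into the non-negative quantities of
    [homg_cross]. *)
Lemma crossg_gt0_nneg d m x w : (0 < m)%N -> (m < d)%N -> 0 <= x -> 0 < w ->
  0 < crossg d m x w.
Proof.
move=> m0 lt_md x0 w0.
have A_gt0 i : (m <= i)%N -> 0 < homg i x w * geom m w - w ^+ i * dgeom m x w.
  move=> le_mi; rewrite /geom /dgeom !big_distrr/= -sumrB.
  (* The term of index 0 is already positive. *)
  case: m m0 {lt_md} le_mi => // m _ le_mi; rewrite big_ord_recl/= ltr_wpDr//.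
    apply: sumr_ge0 => j _.
    rewrite homg_cross; last by rewrite (leq_trans _ le_mi)// leqW// ltn_ord.
    by rewrite mulr_ge0 ?exprn_ge0 ?mulr_ge0 ?homg_ge0// ltW.
  by rewrite expr0 homg0 mulr0 subr0 mulr1 homg_gt0// (leq_trans _ le_mi).
rewrite -(subnKC lt_md); elim: (d - m.+1)%N => [|l IH].
  have -> : crossg (m.+1 + 0) m x w
      = homg m x w * geom m w - w ^+ m * dgeom m x w.
    by rewrite addn0 /crossg dgeomS geomS; ring.
  exact: A_gt0.
rewrite addnS /crossg dgeomS geomS !mulrDl opprD addrACA addr_gt0//.
by apply: A_gt0; rewrite addSn leqW// leq_addr.
Qed.

(** If w and x have different signs, the numbers geom d and geom m compare in
    opposite directions at w and x; if both are negative, multiplying by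
    (1 - x)(1 - w) leaves a combination of homogeneous sums in - x and - w
    with positive value. The hypothesis w != 0 is necessary: for m >= 3 the
    function (x^d - 1) / (x^m - 1) has a critical point at 0. *)
Lemma crossg_gt0 d m x w : odd m -> ~~ odd d -> (m < d)%N -> w != 0 ->
  0 < crossg d m x w.
Proof.
move=> om od lt_md; have m0 : (0 < m)%N by case: m om {lt_md}.
rewrite neq_lt => /orP[w0|w0]; have [x0|x0] := leP 0 x.
- have xw : 0 < x - w by lra.
  rewrite -(pmulr_rgt0 _ xw) crossgE.
  have h1 := geom_even_lt_odd om od w0.
  have h2 := le_geom (ltnW lt_md) x0.
  have h3 := geom_odd_gt0 x om; have h4 := geom_odd_gt0 w om.
  rewrite subr_gt0 (lt_le_trans (y := geom m w * geom m x)) ?ltr_pM2r//.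
  by rewrite mulrC ler_pM2r.
- have x1 : 0 < (1 - w) * (1 - x) by rewrite mulr_gt0; lra.
  rewrite -(pmulr_rgt0 _ x1) -mulrA crossg1B.
  pose X := - x; pose W := - w.
  have hN n : homg n x w = (-1) ^+ n.-1 * homg n X W by rewrite -homgN !opprK.
  have wE : w = - W by rewrite opprK.
  rewrite !hN wE; have X0 : 0 < X by rewrite /X; lra.
  have W0 : 0 < W by rewrite /W; lra.
  have -> : (-1) ^+ m.-1 = 1 :> R.
    by rewrite -signr_odd; case: (m) om => //= ? /negbTE ->.
  have -> : (-1) ^+ d.-1 = -1 :> R.
    rewrite -signr_odd; case: (d) lt_md od => //= ? _; rewrite negbK => ->.
    exact: expr1.
  have e1 n : (1 - - W) * geom n (- W) = 1 - (- W) ^+ n.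
    by rewrite -[LHS]opprK -mulNr opprB geomE opprB.
  have -> : (1 - - W) * (geom d (- W) * (1 * homg m X W)
        - (-1 * homg d X W) * geom m (- W))
      = ((1 - - W) * geom d (- W)) * homg m X W
        + homg d X W * ((1 - - W) * geom m (- W)) by ring.
  rewrite !e1 !(exprNn W) -(signr_odd _ d) -(signr_odd _ m) om (negbTE od) expr0 expr1.
  have -> : (1 - 1 * W ^+ d) * homg m X W + homg d X W * (1 - -1 * W ^+ m)
    = homg m X W + homg d X W
      + (homg d X W * W ^+ m - W ^+ d * homg m X W) by ring.
  rewrite (homg_cross _ _ (ltnW lt_md)) ltr_wpDr//; last first.
    by rewrite addr_gt0// homg_gt0 ?(ltW X0)// (leq_trans _ lt_md).
  by rewrite mulr_ge0 ?homg_ge0 ?exprn_ge0 ?mulr_ge0// ltW.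
- exact: crossg_gt0_nneg.
- have xw : x - w < 0 by lra.
  rewrite -(nmulr_rlt0 _ xw) crossgE.
  have h1 := geom_even_lt_odd om od x0.
  have h2 := le_geom (ltnW lt_md) (ltW w0).
  have h3 := geom_odd_gt0 x om; have h4 := geom_odd_gt0 w om.
  rewrite subr_lt0 (lt_le_trans (y := geom m x * geom m w)) ?ltr_pM2r//.
  by rewrite mulrC ler_pM2r.
Qed.

End Positivity.

(** * Monic polynomials with prescribed real roots and coefficient signs *)

Section PositivePolynomials.
Variable R : realType.
Implicit Types (p q P D : {poly R}) (x y u v : R).

(** Intermediate value theorem. *)
Lemma noroot_gt0 p x0 : (forall x, ~~ root p x) -> 0 < p.[x0] ->
  forall x, 0 < p.[x].
Proof.
move=> nr p0 x; rewrite ltNge; apply/negP => px.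
have [le_x|/ltW le_x] := leP x0 x.
  have : 0 \in `[(- p).[x0], (- p).[x]].
    by rewrite in_itv/= !hornerN oppr_le0 oppr_ge0 px ltW.
  rewrite in_itv => /(poly_ivt le_x)[z _].
  by rewrite rootN; apply/negP.
have : 0 \in `[p.[x], p.[x0]] by rewrite in_itv/= px ltW.
by rewrite in_itv => /(poly_ivt le_x)[z _]; apply/negP.
Qed.

Definition revp n p : {poly R} := \poly_(i < n.+1) p`_(n - i).

Lemma horner_revp n p x : (size p <= n.+1)%N -> x != 0 ->
  (revp n p).[x] = x ^+ n * p.[x^-1].
Proof.
move=> sz x0; rewrite horner_poly (horner_coef_wide _ sz) big_distrr/=.
rewrite (reindex_inj rev_ord_inj)/=; apply: eq_bigr => -[i /= lt_i] _.
rewrite subSS (subKn (_ : (i <= n)%N))// mulrCA; congr (_ * _).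
by rewrite exprVn exprB// unitfE.
Qed.

Lemma revp0 n p : (revp n p).[0] = p`_n.
Proof. by rewrite horner_coef0 coef_poly ltn0Sn subn0. Qed.

(** The sign at infinity is read off at 0 on the reversed polynomial, whose
    constant term is the leading coefficient 1; both polynomials take the
    same value at 1. *)
Lemma monic_noroot_gt0 p : p \is monic -> (forall x, ~~ root p x) ->
  forall x, 0 < p.[x].
Proof.
move=> mp nr; have sz : (0 < size p)%N by rewrite size_poly_gt0 monic_neq0.
pose n := (size p).-1; have szn : (size p <= n.+1)%N by rewrite prednK.
apply: (noroot_gt0 (x0 := 1)) => //.
have <- : (revp n p).[1] = p.[1].
  by rewrite horner_revp ?oner_neq0// expr1n mul1r invr1.
apply: (noroot_gt0 (x0 := 0)) => [x|].
  have [->|x0] := eqVneq x 0.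
    by rewrite rootE revp0 -/(lead_coef p) (monicP mp) oner_neq0.
  rewrite rootE horner_revp// mulf_neq0 ?expf_neq0//; exact: nr.
by rewrite revp0 -/(lead_coef p) (monicP mp).
Qed.

End PositivePolynomials.

Section FactoredPolynomials.
Variables (R : realType) (d : nat).
Implicit Types (a b : 'rV[R]_d) (P D : {poly R}).

Definition lowpoly (a : 'rV[R]_d) : {poly R} := \sum_(j < d) a 0 j *: 'X^j.

Lemma QpolyE a : Qpoly a = 'X^d + lowpoly a.
Proof. by []. Qed.

Lemma size_lowpoly a : (size (lowpoly a) <= d)%N.
Proof.
apply: (leq_trans (size_sum _ _ _)); apply/bigmax_leqP => i _.
by rewrite (leq_trans (size_scale_leq _ _))// size_polyXn.
Qed.

Lemma size_Qpoly a : size (Qpoly a) = d.+1.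
Proof. by rewrite size_polyDl ?size_polyXn// ltnS size_lowpoly. Qed.

Lemma Qpoly_monic a : Qpoly a \is monic.
Proof.
by rewrite monicE lead_coefDl ?lead_coefXn// size_polyXn ltnS size_lowpoly.
Qed.

Lemma Qpoly_neq0 a : Qpoly a != 0.
Proof. exact/monic_neq0/Qpoly_monic. Qed.

Lemma horner_Qpoly a x : (Qpoly a).[x] = x ^+ d + \sum_(j < d) a 0 j * x ^+ j.
Proof.
rewrite hornerD hornerXn horner_sum; congr (_ + _).
by apply: eq_bigr => j _; rewrite hornerZ hornerXn.
Qed.

Lemma lowpolyZ (c : R) a : lowpoly (c *: a) = c *: lowpoly a.
Proof.
by rewrite /lowpoly scaler_sumr; apply: eq_bigr => j _; rewrite mxE scalerA.
Qed.

Lemma lowpolyD a b : lowpoly (a + b) = lowpoly a + lowpoly b.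
Proof.
by rewrite /lowpoly -big_split; apply: eq_bigr => j _; rewrite mxE scalerDl.
Qed.

Lemma Qpoly_conv (t : R) a b :
  Qpoly ((1 - t) *: a + t *: b) = (1 - t) *: Qpoly a + t *: Qpoly b.
Proof.
rewrite !QpolyE lowpolyD !lowpolyZ !scalerDr addrACA -scalerDl subrK.
by rewrite scale1r.
Qed.

(** The coefficients of r^d Q(x / r): the roots are multiplied by r and the
    signs of the coefficients are kept. *)
Definition rescale (r : R) a : 'rV[R]_d := \row_j (a 0 j * r ^+ (d - j)).

Lemma rescaleK (r : R) a : r != 0 -> rescale r (rescale r^-1 a) = a.
Proof.
move=> r0; apply/rowP => j; rewrite !mxE -mulrA -exprMn.
by rewrite mulVf// expr1n mulr1.
Qed.

Lemma rescale1 a : rescale 1 a = a.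
Proof. by apply/rowP => j; rewrite mxE expr1n mulr1. Qed.

Lemma Qpoly_rescale (r : R) a : r != 0 ->
  Qpoly (rescale r a) = r ^+ d *: (Qpoly a \Po (r^-1 *: 'X)).
Proof.
move=> r0; rewrite !QpolyE comp_polyD scalerDr comp_Xn_poly exprZn scalerA.
rewrite -exprMn mulfV// expr1n scale1r; congr (_ + _).
rewrite /lowpoly rmorph_sum/= scaler_sumr; apply: eq_bigr => -[j /= lt_j] _.
rewrite mxE/= comp_polyZ comp_Xn_poly exprZn !scalerA; congr (_ *: _).
by rewrite exprB ?unitfE ?(ltnW lt_j)// exprVn; ring.
Qed.

Lemma has_signsP (sigma : 'I_d -> csign) a :
  has_signs sigma a <-> forall j, 0 < csign_val R (sigma j) * a 0 j.
Proof.
split=> h j; move: (h j); case: (sigma j) => /=.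
- by move/eqP; rewrite sgr_cp0 mul1r.
- by move/eqP; rewrite sgr_cp0 mulN1r oppr_gt0.
- by rewrite mul1r => /gtr0_sg.
- by rewrite mulN1r oppr_gt0 => /ltr0_sg.
Qed.

Section Fiber.
Variable sigma : 'I_d -> csign.

(** Positivity of the cofactor P says that the real roots of Q, with
    multiplicities, are those of D. *)
Definition fiber (D : {poly R}) : set 'rV[R]_d :=
  [set a | has_signs sigma a /\
           exists2 P, Qpoly a = D * P & forall x, 0 < P.[x]].

Lemma fiber_conv D a b (t : R) : 0 <= t <= 1 -> fiber D a -> fiber D b ->
  fiber D ((1 - t) *: a + t *: b).
Proof.
have conv_gt0 y z : 0 <= t <= 1 -> 0 < y -> 0 < z -> 0 < (1 - t) * y + t * z.
  move=> /andP[t0 t1] y0 z0; have [->|tn1] := eqVneq t 1.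
    by rewrite subrr mul0r add0r mul1r.
  by rewrite ltr_pwDl ?mulr_ge0 ?(ltW z0)// mulr_gt0// subr_gt0 lt_neqAle tn1.
move=> t01 [/has_signsP sa [P QP P0]] [/has_signsP sb [P' QP' P'0]]; split.
  apply/has_signsP => j; rewrite !mxE mulrDr mulrCA [X in _ + X]mulrCA.
  exact: conv_gt0.
exists ((1 - t) *: P + t *: P').
  by rewrite Qpoly_conv QP QP' mulrDr !scalerAr.
by move=> x; rewrite hornerD !hornerZ conv_gt0.
Qed.

(** The positive constant c allows one to use the statement when D composed
    with x / r is proportional to a monic D'. *)
Lemma fiber_rescale (r c : R) D D' a : 0 < r -> 0 < c ->
  D \Po (r^-1 *: 'X) = c *: D' -> fiber D a -> fiber D' (rescale r a).
Proof.
move=> r0 c0 eD [/has_signsP sa [P QP P0]]; split.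
  by apply/has_signsP => j; rewrite mxE mulrA mulr_gt0 ?exprn_gt0.
exists ((r ^+ d * c) *: (P \Po (r^-1 *: 'X))).
  rewrite Qpoly_rescale ?gt_eqF// QP comp_polyM eD -scalerAl -scalerAr scalerA.
  by rewrite scalerAr.
by move=> x; rewrite hornerZ horner_comp !mulr_gt0 ?exprn_gt0.
Qed.

Lemma EsetE : @Eset R d sigma = fiber 1.
Proof.
apply/seteqP; split=> a [].
  move=> ell sa; split=> //; exists (Qpoly a); rewrite ?mul1r//.
  by apply: monic_noroot_gt0 => [|x]; [exact: Qpoly_monic|exact/negP/ell].
move=> sa [P QP P0]; split=> // x; rewrite QP mul1r rootE.
by apply/negP; rewrite gt_eqF.
Qed.

Lemma mup1_factor (p : {poly R}) x : p != 0 -> mup x p = 1%N ->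
  exists2 q, p = ('X - x%:P) * q & ~~ root q x.
Proof.
move=> p0 mp1; have : ('X - x%:P %| p)%R by rewrite XsubC_dvd// mp1.
rewrite dvdp_XsubCl => /factor_theorem[q pq]; exists q; first by rewrite mulrC.
apply/negP => /factor_theorem[q' qq'].
have : (mup x p <= 1)%N by rewrite mp1.
by rewrite mup_leq// pq qq' -mulrA -expr2 dvdp_mulIr.
Qed.

Lemma mup_XsubC1 (x : R) : mup x ('X - x%:P) = 1%N.
Proof. by rewrite -[X in mup _ X]expr1 mup_XsubCX eqxx. Qed.

Lemma FsetP a : @Fset R d sigma a <-> exists u, fiber ('X - u%:P) a.
Proof.
split=> [[sa [u [ru mu1]]]|[u [sa [P QP P0]]]].
  exists u; split=> //; have [P QP Pu] := mup1_factor (Qpoly_neq0 a) mu1.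
  exists P => //; apply: monic_noroot_gt0.
    by rewrite -(monicMl _ (monicXsubC u)) -QP Qpoly_monic.
  move=> x; apply/negP => rP; have /ru xu : root (Qpoly a) x.
    by rewrite QP rootM rP orbT.
  by rewrite -xu rP in Pu.
have nrP z : root P z = false by rewrite rootE gt_eqF.
split=> //; exists u; split=> [z|]; rewrite QP.
  by rewrite rootM nrP orbF root_XsubC; split=> /eqP.
by rewrite mupMl ?nrP// mup_XsubC1.
Qed.

Lemma GsetP a : @Gset R d sigma a <->
  exists2 uv : R * R, uv.2 < uv.1 &
    fiber (('X - uv.1%:P) * ('X - uv.2%:P)) a.
Proof.
split=> [[sa [x [y [xy rz mx my]]]]|[[u v] /= vu [sa [P QP P0]]]].
  wlog yx : x y xy rz mx my / y < x.
    move=> W; move/eqP: (xy); rewrite neq_lt => /orP[lt|lt]; last exact: (W x y).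
    apply: (W y x) => //; first by move=> /esym.
    by move=> z; rewrite rz; split=> -[]; tauto.
  exists (x, y) => //=; split=> //.
  have [q Qq qx] := mup1_factor (Qpoly_neq0 a) mx.
  have nyx : ~~ root ('X - x%:P) y by rewrite root_XsubC lt_eqF.
  have mqy : mup y q = 1%N by rewrite -my Qq mupMr.
  have q0 : q != 0.
    by apply: contraTneq (Qpoly_neq0 a) => q0; rewrite Qq q0 mulr0 eqxx.
  have [P qP Py] := mup1_factor q0 mqy.
  have QP : Qpoly a = ('X - x%:P) * ('X - y%:P) * P by rewrite Qq qP mulrA.
  have mD : ('X - x%:P) * ('X - y%:P) \is monic by rewrite monicMl ?monicXsubC.
  exists P => //; apply: monic_noroot_gt0.
    by rewrite -(monicMl P mD) -QP Qpoly_monic.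
  move=> z; apply/negP => rP; have /rz[zx|zy] : root (Qpoly a) z.
  - by rewrite QP rootM rP orbT.
  - by move: qx; rewrite qP rootM -zx rP orbT.
  - by rewrite -zy rP in Py.
have nrP z : root P z = false by rewrite rootE gt_eqF.
split=> //; exists u, v; split.
- by move=> uv; rewrite uv ltxx in vu.
- move=> z; rewrite QP !rootM nrP orbF !root_XsubC.
  by split=> [/orP[]/eqP->|[->|->]]; rewrite ?eqxx ?orbT; auto.
- rewrite QP -mulrA mupMl ?mup_XsubC1//.
  by rewrite rootM nrP orbF root_XsubC gt_eqF.
- rewrite QP -mulrA mulrCA mupMl ?mup_XsubC1//.
  by rewrite rootM nrP orbF root_XsubC lt_eqF.
Qed.

End Fiber.
End FactoredPolynomials.

(** * The margin of a positive polynomial *)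

Section Margin.
Variables (R : realType) (n : nat).
Hypothesis n_even : ~~ odd n.
Implicit Types (p q : {poly R}) (x : R).

Let wt x : R := 1 + x ^+ n.

Let wt_gt0 x : 0 < wt x.
Proof. by rewrite ltr_wpDr ?exprn_even_ge0. Qed.

Definition l1norm p : R := \sum_(i < n.+1) `|p`_i|.

Lemma l1norm_ge0 p : 0 <= l1norm p.
Proof. exact: sumr_ge0. Qed.

(** Each |x|^i with i <= n is at most 1 if |x| <= 1, and at most x^n
    otherwise; here n is even. *)
Lemma horner_le_l1norm p x : (size p <= n.+1)%N ->
  `|p.[x]| <= l1norm p * wt x.
Proof.
move=> sz; rewrite (horner_coef_wide _ sz) /l1norm big_distrl/=.
apply: (le_trans (ler_norm_sum _ _ _)); apply: ler_sum => -[i /= lt_i] _.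
rewrite normrM ler_wpM2l// normrX /wt -(ger0_norm (exprn_even_ge0 x n_even)).
rewrite normrX; have [x1|/ltW x1] := leP `|x| 1.
  by rewrite ler_wpDr ?exprn_ge0 ?exprn_ile1.
by rewrite ler_wpDl// ler_weXn2l.
Qed.

(** Dividing by 1 + x^n compactifies the line: for polynomials of degree at
    most n this infimum measures positivity uniformly up to infinity. *)
Definition margin p : R := inf [set p.[x] / wt x | x in setT].

Let margin_has_inf p : (size p <= n.+1)%N ->
  has_inf [set p.[x] / wt x | x in setT].
Proof.
move=> sz; split; first by exists (p.[0] / wt 0), 0.
exists (- l1norm p) => _ [x _ <-].
rewrite ler_pdivlMr// mulNr lerNl (le_trans _ (horner_le_l1norm x sz))//.
by rewrite -normrN ler_norm.
Qed.

Lemma marginP p x : (size p <= n.+1)%N -> margin p * wt x <= p.[x].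
Proof.
move=> sz; rewrite -ler_pdivlMr//; apply: ge_inf; last by exists x.
by have [] := margin_has_inf sz.
Qed.

(** The values of p and q at x differ by at most the norm of p - q times
    1 + x^n. Exchanging p and q, one sees that the margin is 1-Lipschitz. *)
Lemma margin_le p q : (size p <= n.+1)%N -> (size q <= n.+1)%N ->
  margin p <= margin q + l1norm (p - q).
Proof.
move=> szp szq; rewrite -lerBlDr; apply: lb_le_inf.
  by exists (q.[0] / wt 0), 0.
move=> _ [x _ <-]; rewrite ler_pdivlMr// mulrBl lerBlDr.
apply: le_trans (marginP x szp) _; rewrite -lerBlDl -hornerN -hornerD.
rewrite (le_trans (ler_norm _))// horner_le_l1norm//.
by rewrite (leq_trans (size_polyD _ _))// geq_max szp size_polyN.
Qed.

Lemma poly_pos_itv_lb p : (forall x, `|x| <= 1 -> 0 < p.[x]) ->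
  exists2 m : R, 0 < m & forall x, `|x| <= 1 -> m <= p.[x].
Proof.
move=> p0; have cp : {within `[-1, 1], continuous (horner p)}.
  by apply: continuous_subspaceT; exact: continuous_horner.
have [|c c1 minc] := EVT_min _ cp; first by lra.
exists p.[c]; first by apply: p0; rewrite ler_norml; move: c1; rewrite in_itv.
by move=> x x1; apply: minc; rewrite in_itv/= -ler_norml.
Qed.

(** On [-1, 1] the extreme value theorem applies to p; outside, p(x) / x^n is
    the value at 1 / x of the reversed polynomial, to which it applies again. *)
Lemma margin_gt0 p : (size p <= n.+1)%N -> 0 < p`_n ->
  (forall x, 0 < p.[x]) -> 0 < margin p.
Proof.
move=> sz pn p0.
have [m1 m10 hm1] := poly_pos_itv_lb (fun x _ => p0 x).
have [|m2 m20 hm2] := @poly_pos_itv_lb (revp n p).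
  move=> x _; have [->|x0] := eqVneq x 0; first by rewrite revp0.
  by rewrite horner_revp// mulr_gt0// lt0r expf_neq0// exprn_even_ge0.
pose m := Num.min m1 m2; have m0 : 0 < m by rewrite lt_min m10.
apply: (lt_le_trans (y := m / 2)); first by rewrite divr_gt0.
apply: lb_le_inf; first by exists (p.[0] / wt 0), 0.
move=> _ [x _ <-]; rewrite ler_pdivlMr//.
have [x1|/ltW x1] := leP `|x| 1.
  have xn : x ^+ n <= 1.
    by rewrite -(ger0_norm (exprn_even_ge0 x n_even)) normrX exprn_ile1.
  have : m <= p.[x] by rewrite (le_trans _ (hm1 _ x1))// ge_min lexx.
  by rewrite /wt; nra.
have x0 : x != 0 by rewrite -normr_gt0 (lt_le_trans ltr01).
have xn : 1 <= x ^+ n.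
  by rewrite -(ger0_norm (exprn_even_ge0 x n_even)) normrX exprn_ege1.
have : m * x ^+ n <= p.[x].
  have -> : p.[x] = (revp n p).[x^-1] * x ^+ n.
    rewrite horner_revp ?invr_eq0// invrK mulrAC exprVn mulVf ?mul1r//.
    by rewrite expf_neq0.
  rewrite ler_wpM2r ?(le_trans ler01)// (le_trans _ (hm2 _ _))//.
    by rewrite ge_min lexx orbT.
  by rewrite normfV invf_le1// (lt_le_trans ltr01).
by rewrite /wt; nra.
Qed.

Lemma horner_perturb_gt0 p q e x : (size p <= n.+1)%N -> (size q <= n.+1)%N ->
  0 <= e -> e * l1norm q < margin p -> 0 < (p + e *: q).[x].
Proof.
move=> szp szq e0 eq; rewrite hornerD hornerZ.
have : e * l1norm q * wt x < margin p * wt x by rewrite ltr_pM2r.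
have := marginP x szp; have := horner_le_l1norm x szq.
have : - `|q.[x]| <= q.[x] by rewrite lerNl -normrN ler_norm.
move=> h1 h2 h3 h4.
suff : - (e * l1norm q * wt x) <= e * q.[x] by lra.
by rewrite -mulrA -mulrN ler_wpM2l// (le_trans _ h1)// lerN2.
Qed.

Lemma cvg_l1norm (T : Type) (F : set_system T) (p : T -> {poly R}) q :
  Filter F -> (forall i, (p z)`_i @[z --> F] --> q`_i) ->
  l1norm (p z) @[z --> F] --> l1norm q.
Proof.
move=> FF cp; apply: cvg_big => [|i _]; first exact: add_continuous.
 apply: cvg_norm; exact: cp.
Qed.

Lemma cvg_margin (T : Type) (F : set_system T) (p : T -> {poly R}) q :
  Filter F -> (forall z, size (p z) <= n.+1)%N -> (size q <= n.+1)%N ->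
  (forall i, (p z)`_i @[z --> F] --> q`_i) ->
  margin (p z) @[z --> F] --> margin q.
Proof.
move=> FF szp szq cp.
have c0 : l1norm (p z - q) @[z --> F] --> (0 : R).
  rewrite (_ : 0 = l1norm 0); last first.
    by rewrite /l1norm big1// => i _; rewrite coef0 normr0.
  apply: cvg_l1norm => i.
  rewrite [X in _ --> X](_ : _ = q`_i - q`_i); last by rewrite coef0 subrr.
  under eq_fun => z do rewrite coefB.
  by apply: cvgB; [exact: cp|exact: cvg_cst].
apply/cvgrPdist_le => e e0; move/cvgrPdist_le : c0 => /(_ e e0).
apply: filterS => z; rewrite sub0r normrN ger0_norm ?l1norm_ge0// => h.
have h1 := margin_le (szp z) szq; have h2 := margin_le szq (szp z).
have eqB : l1norm (q - p z) = l1norm (p z - q).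
  by apply: eq_bigr => i _; rewrite !coefB distrC.
rewrite eqB in h2; rewrite ler_norml lerBrDl lerBlDl.
by apply/andP; split; lra.
Qed.

End Margin.

(** * Perturbing the signs inside a fiber *)

Section FiberSection.
Variable R : realType.

Lemma cvg_rV (d : nat) (T : Type) (F : set_system T) (f : T -> 'rV[R]_d)
    (a : 'rV[R]_d) :
  Filter F -> (forall j, f z 0 j @[z --> F] --> a 0 j) -> f @ F --> a.
Proof.
move=> FF cf; rewrite (row_sum_delta a).
rewrite [X in X @ _](_ : f = fun z => \sum_j f z 0 j *: delta_mx 0 j); last first.
  by apply/funext => z; exact: row_sum_delta.
apply: cvg_big => [|j _]; first exact: add_continuous.
exact: cvgZ (cf j) (cvg_cst _).
Qed.

(** Here q is a base point whose coefficients may vanish or have the right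
    signs, and t is a perturbation in the direction of the missing signs,
    both divisible by D. The section is q + t / bnd, where bnd is larger than
    each of the finitely many quantities that bound the size of an admissible
    perturbation: the ratios |t_j| / |q_j| for the coefficients that already
    have their signs, and the norm of the cofactor of t divided by the margin
    of that of q. Summing these quantities, rather than taking their maximum,
    makes bnd continuous in w. *)
Lemma fiber_section (d n : nat) (sigma : 'I_d -> csign) (B : set R)
    (D P S : R -> {poly R}) (q t : R -> 'rV[R]_d) :
  (n <= d)%N -> ~~ odd n ->
  (forall w, D w \is monic) -> (forall w, size (D w) = (d - n).+1) ->
  (forall w, Qpoly (q w) = D w * P w) ->
  (forall w, lowpoly (t w) = D w * S w) ->
  (forall w x, B w -> 0 < (P w).[x]) ->
  (forall j, (forall w, B w -> 0 < csign_val R (sigma j) * q w 0 j) \/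
     (forall w, B w -> 0 <= csign_val R (sigma j) * q w 0 j /\
                       0 < csign_val R (sigma j) * t w 0 j)) ->
  (forall j, continuous (fun w => q w 0 j)) ->
  (forall j, continuous (fun w => t w 0 j)) ->
  (forall i, continuous (fun w => (P w)`_i)) ->
  (forall i, continuous (fun w => (S w)`_i)) ->
  exists s : R -> 'rV[R]_d, forall w, B w ->
    fiber sigma (D w) (s w) /\ s z @[z --> w] --> s w.
Proof.
move=> le_nd n_even mD szD QE TE P_gt0 sgn cq ct cP cS.
have szP w : size (P w) = n.+1.
  have : (0 < size (P w))%N.
    rewrite size_poly_gt0; apply: contraNneq (Qpoly_neq0 (q w)) => P0.
    by rewrite QE P0 mulr0.
  have := size_Qpoly (q w); rewrite QE size_monicM ?mD// ?szD; first lia.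
  by apply: contraNneq (Qpoly_neq0 (q w)) => P0; rewrite QE P0 mulr0.
have mP w : (P w)`_n = 1.
  have : P w \is monic by rewrite -(monicMl _ (mD w)) -QE Qpoly_monic.
  by move/monicP; rewrite /lead_coef szP.
have szS w : (size (S w) <= n.+1)%N.
  have [->|S0] := eqVneq (S w) 0; first by rewrite size_poly0.
  have := size_lowpoly (t w); rewrite TE size_monicM ?mD// szD; lia.
(* The coefficients of the base point that already have their signs. *)
pose str j := `[< forall w, B w -> 0 < csign_val R (sigma j) * q w 0 j >].
pose kap j w := if str j then `|t w 0 j| / (csign_val R (sigma j) * q w 0 j) else 0.
pose bnd w := 1 + \sum_j kap j w + l1norm n (S w) / margin n (P w).
have kap_ge0 j w : B w -> 0 <= kap j w.
  move=> Bw; rewrite /kap; case: ifPn => // /asboolP h.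
  by rewrite divr_ge0// ltW// h.
have mg0 w : B w -> 0 < margin n (P w).
  by move=> Bw; apply: margin_gt0 => [//||//|x]; rewrite ?szP ?mP ?P_gt0.
have sum_ge0 w : B w -> 0 <= \sum_j kap j w.
  by move=> Bw; apply: sumr_ge0 => j _; exact: kap_ge0.
have lm_ge0 w : B w -> 0 <= l1norm n (S w) / margin n (P w).
  by move=> Bw; rewrite divr_ge0 ?l1norm_ge0// ltW// mg0.
have bnd_gt0 w : B w -> 0 < bnd w.
  by move=> Bw; have := sum_ge0 w Bw; have := lm_ge0 w Bw; rewrite /bnd; lra.
exists (fun w => q w + (bnd w)^-1 *: t w) => w Bw; split; last first.
  have cbnd : bnd z @[z --> w] --> bnd w.
    apply: cvgD; first apply: cvgD; first exact: cvg_cst.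
      apply: cvg_big => [|j _]; first exact: add_continuous.
      rewrite /kap; case: ifPn => [/asboolP h|_]; last exact: cvg_cst.
      apply: cvgM; first by apply: cvg_norm; exact: ct.
      apply: cvgV; first by rewrite gt_eqF// h.
      by apply: cvgM; [exact: cvg_cst|exact: cq].
    apply: cvgM; first by apply: cvg_l1norm => i; exact: cS.
    apply: cvgV; first by rewrite gt_eqF// mg0.
    by apply: cvg_margin => // [z||i]; rewrite ?szP//; exact: cP.
  apply: cvg_rV => j; rewrite !mxE.
  under eq_fun => z do rewrite !mxE.
  apply: cvgD; first exact: cq.
  by apply: cvgM; [apply: cvgV; rewrite ?gt_eqF ?bnd_gt0|exact: ct].
have b0 := bnd_gt0 w Bw; split.
  apply/has_signsP => j; rewrite !mxE mulrDr.
  have [/asboolP h|/asboolPn h] := boolP (str j); last first.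
    have [//|/(_ w Bw)[q0 t0]] := sgn j.
    by rewrite ltr_wpDl// mulrCA mulr_gt0// invr_gt0.
  have q0 := h w Bw; rewrite -ltrBlDl sub0r.
  have lt_kap : kap j w < bnd w.
    rewrite /bnd; have := lm_ge0 w Bw; rewrite (bigD1 j)//=.
    have : 0 <= \sum_(i < d | i != j) kap i w.
      by apply: sumr_ge0 => i _; exact: kap_ge0.
    lra.
  move: lt_kap; rewrite /kap /str (asboolT h) ltr_pdivrMr// => lt_t.
  rewrite ltrNl mulrCA -mulrN -ltr_pdivlMl ?invr_gt0// invrK.
  rewrite (le_lt_trans _ lt_t)// (le_trans (ler_norm _))// normrN normrM.
  by case: (sigma j) => /=; rewrite ?normrN1 ?normr1 mul1r.
exists (P w + (bnd w)^-1 *: S w).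
  by rewrite QpolyE lowpolyD lowpolyZ addrA -QpolyE QE TE mulrDr scalerAr.
move=> x; apply: (horner_perturb_gt0 (n := n)) => //; rewrite ?szP//.
  by rewrite invr_ge0 ltW.
rewrite mulrC ltr_pdivrMr// -ltr_pdivrMl ?mg0// mulrC.
by have := sum_ge0 w Bw; rewrite /bnd; lra.
Qed.

End FiberSection.

(** * Contracting a family of convex fibers *)

Section Fibration.
Variable R : realType.

(** During the first half of the time lam grows from 0 to 1 and w is fixed,
    so that the rescaled point moves inside one convex fiber towards the
    section; during the second half lam = 1 and the point follows the section
    to w0. The scale goes from r a to 1 during the whole time. *)
Lemma contractible_fibration (d : nat) (A : set 'rV[R]_d)
    (fib : R -> set 'rV[R]_d) (B : set R) (w0 : R)
    (r w : 'rV[R]_d -> R) (s : R -> 'rV[R]_d) :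
  B w0 ->
  (forall x y (t : R), 0 <= t <= 1 -> B x -> B y -> B ((1 - t) * x + t * y)) ->
  (forall x a b (t : R), 0 <= t <= 1 -> fib x a -> fib x b ->
     fib x ((1 - t) *: a + t *: b)) ->
  (forall a, A a -> [/\ 0 < r a, B (w a) & fib (w a) (rescale (r a)^-1 a)]) ->
  (forall x b (rho : R), B x -> 0 < rho -> fib x b -> A (rescale rho b)) ->
  (forall a, A a -> r @ within A (nbhs a) --> r a) ->
  (forall a, A a -> w @ within A (nbhs a) --> w a) ->
  (forall x, B x -> fib x (s x) /\ s z @[z --> x] --> s x) ->
  contractible R A.
Proof.
move=> Bw0 Bconv fibconv Afib fibA cr cw cs.
exists (s w0); split.
  by rewrite -(rescale1 (s w0)); apply: (fibA w0) => //; have [] := cs _ Bw0.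
pose lam (t : R) := Num.min (2 * t) 1; pose tau (t : R) := Num.max 0 (2 * t - 1).
pose rad (p : 'rV[R]_d * R) := (1 - p.2) * r p.1 + p.2.
pose wt (p : 'rV[R]_d * R) := (1 - tau p.2) * w p.1 + tau p.2 * w0.
pose K p := (1 - lam p.2) *: rescale (r p.1)^-1 p.1 + lam p.2 *: s (wt p).
pose H p := rescale (rad p) (K p).
have tau01 t : 0 <= t <= 1 -> 0 <= tau t <= 1.
  by move=> t01; rewrite /tau; apply/andP; split; case: (leP 0 (2 * t - 1)); lra.
have lam01 t : 0 <= t <= 1 -> 0 <= lam t <= 1.
  by move=> t01; rewrite /lam; apply/andP; split; case: (leP (2 * t) 1); lra.
have Bwt a t : A a -> 0 <= t <= 1 -> B (wt (a, t)).
  move=> Aa t01; have [_ Bwa _] := Afib a Aa.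
  by rewrite /wt /=; apply: Bconv => //; exact: tau01.
exists H; split.
- apply/subspace_continuousP => -[a t] [/= Aa t01].
  move: t01; rewrite in_itv/= => t01; have [r0 Bwa fa] := Afib a Aa.
  set F := within _ _; have FF : Filter F by exact: within_filter.
  have c2 : p.2 @[p --> F] --> t by apply: cvg_within_filter; exact: cvg_snd.
  have c1 : p.1 @[p --> F] --> a by apply: cvg_within_filter; exact: cvg_fst.
  have c1A : p.1 @[p --> F] --> within A (nbhs a).
    move=> U AU; have c0 : p.1 @[p --> (a, t)] --> a by exact: cvg_fst.
    apply: (@filterS _ (nbhs (a, t)) _ _ _ _ (c0 _ AU)) => p /= h [Ap _].
    exact: h.
  have crF : r p.1 @[p --> F] --> r a by exact: (cvg_comp _ _ c1A (cr a Aa)).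
  have cwF : w p.1 @[p --> F] --> w a by exact: (cvg_comp _ _ c1A (cw a Aa)).
  have clam : lam p.2 @[p --> F] --> lam t.
    apply: (cvg_comp _ _ c2); apply: (@continuous_min R R (fun x => 2 * x) (fun=> 1)).
      by apply: cvgM; [exact: cvg_cst|exact: cvg_id].
    exact: cvg_cst.
  have ctau : tau p.2 @[p --> F] --> tau t.
    apply: (cvg_comp _ _ c2); apply: (@continuous_max R R (fun=> 0) (fun x => 2 * x - 1)).
      exact: cvg_cst.
    apply: cvgB; last exact: cvg_cst.
    by apply: cvgM; [exact: cvg_cst|exact: cvg_id].
  have cwt : wt p @[p --> F] --> wt (a, t).
    apply: cvgD; apply: cvgM => //; last exact: cvg_cst.
    by apply: cvgB => //; exact: cvg_cst.
  have crad : rad p @[p --> F] --> rad (a, t).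
    apply: cvgD => //; apply: cvgM => //.
    by apply: cvgB => //; exact: cvg_cst.
  have csF : s (wt p) @[p --> F] --> s (wt (a, t)).
    by apply: (cvg_comp _ _ cwt); have [] := cs _ (Bwt a t Aa t01).
  have cX (f : 'rV[R]_d * R -> R) (l : R) k : f p @[p --> F] --> l ->
      f p ^+ k @[p --> F] --> l ^+ k.
    by move=> cf; apply: (cvg_comp _ (fun y => y ^+ k) cf); exact: exprn_continuous.
  have cj (f : 'rV[R]_d * R -> 'rV[R]_d) (l : 'rV[R]_d) j : f p @[p --> F] --> l ->
      f p 0 j @[p --> F] --> l 0 j.
    move=> cf; apply: (cvg_comp _ (fun M : 'rV[R]_d => M 0 j) cf).
    exact: coord_continuous.
  apply: cvg_rV => j; rewrite /H /K !mxE.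
  under eq_fun => p do rewrite !mxE.
  apply: cvgM; last exact: cX.
  apply: cvgD; apply: cvgM => //.
  + by apply: cvgB => //; exact: cvg_cst.
  + apply: cvgM; first exact: cj.
    by apply: cX; apply: cvgV => //; rewrite gt_eqF.
  + exact: cj.
- move=> a t Aa t01; have [r0 Bwa fa] := Afib a Aa.
  have [t0 t1] := andP t01.
  apply: (fibA (wt (a, t))); first exact: Bwt.
    rewrite /rad /=; have [->|tn1] := eqVneq t 1; first by lra.
    by rewrite ltr_pwDl// mulr_gt0// subr_gt0 lt_neqAle tn1.
  have [fs _] := cs _ (Bwt a t Aa t01).
  (* In the first half wt (a, t) = w a, in the second one lam t = 1. *)
  have [t2|t2] := leP (2 * t) 1.
    apply: fibconv => //; first exact: lam01.
    by rewrite /wt /tau /= max_l ?subr_le0// subr0 mul0r addr0 mul1r.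
  by rewrite /K /lam /= min_r ?(ltW t2)// subrr scale0r add0r scale1r.
- move=> a Aa; have [r0 _ _] := Afib a Aa.
  rewrite /H /K /rad /lam /= subr0 mul1r addr0 mulr0 min_l// subr0 scale1r.
  by rewrite scale0r addr0 rescaleK// gt_eqF.
- move=> a Aa; rewrite /H /K /rad /wt /lam /tau /=.
  rewrite subrr mul0r add0r rescale1 mulr1 min_r ?ler1n// subrr scale0r add0r.
  rewrite scale1r max_r ?subr_ge0 ?ler1n//.
  have -> : 2 - 1 = 1 :> R by lra.
  by rewrite subrr mul0r add0r mul1r.
Qed.

End Fibration.

(** * Continuity of the simple roots *)

Section RootContinuity.
Variables (R : realType) (d : nat).
Implicit Types (a b : 'rV[R]_d) (x u v : R).

Lemma cvg_Qpoly (F : set_system 'rV[R]_d) a x : Filter F -> F --> a ->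
  (Qpoly b).[x] @[b --> F] --> (Qpoly a).[x].
Proof.
move=> FF Fa; rewrite horner_Qpoly (funext (fun b : 'rV[R]_d => horner_Qpoly b x)).
apply: cvgD; first exact: cvg_cst.
apply: cvg_big => [|j _]; first exact: add_continuous.
apply: cvgM; last exact: cvg_cst.
apply: (cvg_trans (cvg_app (fun b : 'rV[R]_d => b 0 j) Fa)).
exact: coord_continuous.
Qed.

Lemma near_Qpoly_gt0 a x : 0 < (Qpoly a).[x] ->
  \forall b \near a, 0 < (Qpoly b).[x].
Proof.
move=> Qa.
have cQ : (Qpoly b).[x] @[b --> nbhs a] --> (Qpoly a).[x].
  have cI : nbhs a --> a by [].
  exact: (@cvg_Qpoly (nbhs a) a x _ cI).
exact: (cvgr_gt _ cQ).
Qed.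

Lemma near_Qpoly_lt0 a x : (Qpoly a).[x] < 0 ->
  \forall b \near a, (Qpoly b).[x] < 0.
Proof.
move=> Qa.
have cQ : (Qpoly b).[x] @[b --> nbhs a] --> (Qpoly a).[x].
  have cI : nbhs a --> a by [].
  exact: (@cvg_Qpoly (nbhs a) a x _ cI).
exact: (cvgr_lt _ cQ).
Qed.

Lemma sign_linear (Q P : {poly R}) x u : (forall y, 0 < P.[y]) ->
  Q = ('X - u%:P) * P -> (Q.[x] < 0) = (x < u) /\ (0 < Q.[x]) = (u < x).
Proof.
move=> P0 ->; rewrite hornerM hornerXsubC pmulr_llt0// pmulr_lgt0//.
by rewrite subr_lt0 subr_gt0.
Qed.

Lemma sign_quadratic (Q P : {poly R}) x u v : (forall y, 0 < P.[y]) -> v < u ->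
  Q = ('X - u%:P) * ('X - v%:P) * P ->
  (Q.[x] < 0) = (v < x < u) /\ (0 < Q.[x]) = (x < v) || (u < x).
Proof.
move=> P0 vu ->; rewrite !hornerM !hornerXsubC pmulr_llt0// pmulr_lgt0//.
have [xv|xv|->] := ltgtP x v; have [xu|xu|xu] := ltgtP x u; split; rewrite /=; nra.
Qed.

Variables (sigma : 'I_d -> csign) (A : set 'rV[R]_d).

(** The polynomial of a is negative at u a - e and positive at u a + e. These
    are open conditions on a, and they place the root of any nearby member of
    A between the two points. *)
Lemma cvg_simple_root (u : 'rV[R]_d -> R) :
  (forall a, A a -> fiber sigma ('X - (u a)%:P) a) ->
  forall a, A a -> u @ within A (nbhs a) --> u a.
Proof.
move=> hA a Aa; apply/cvgrPdist_lt => e e0.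
have [_ [P QP P0]] := hA a Aa.
have hlt : (Qpoly a).[u a - e] < 0 by rewrite (sign_linear _ P0 QP).1; lra.
have hgt : 0 < (Qpoly a).[u a + e] by rewrite (sign_linear _ P0 QP).2; lra.
rewrite near_withinE; near=> b => Ab.
have [_ [P' QP' P'0]] := hA b Ab.
have : (Qpoly b).[u a - e] < 0 by near: b; exact: near_Qpoly_lt0.
have : 0 < (Qpoly b).[u a + e] by near: b; exact: near_Qpoly_gt0.
rewrite (sign_linear _ P'0 QP').2 (sign_linear _ P'0 QP').1 => h1 h2.
by rewrite ltr_norml; apply/andP; split; lra.
Unshelve. all: by end_near. Qed.

(** The polynomial is negative exactly between its two roots. For e smaller
    than their distance, its signs at the four points u - e, u + e, v - e,
    v + e persist nearby and determine both roots up to e. *)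
Lemma cvg_two_roots (u v : 'rV[R]_d -> R) :
  (forall a, A a -> v a < u a /\
     fiber sigma (('X - (u a)%:P) * ('X - (v a)%:P)) a) ->
  forall a, A a -> u @ within A (nbhs a) --> u a /\
                   v @ within A (nbhs a) --> v a.
Proof.
move=> hA a Aa; have [vu [_ [P QP P0]]] := hA a Aa.
suff h e : 0 < e -> e < u a - v a -> \forall b \near within A (nbhs a),
    `|u a - u b| < e /\ `|v a - v b| < e.
  have sub e : 0 < e -> exists e', [/\ 0 < e', e' <= e & e' < u a - v a].
    move=> e0; have [le_e|lt_e] := leP e ((u a - v a) / 2).
      by exists e; split; lra.
    by exists ((u a - v a) / 2); split; lra.
  split; apply/cvgrPdist_lt => e /sub[e' [e'0 e'e e'd]];
    by have := h e' e'0 e'd; apply: filterS => b [h1 h2]; apply: lt_le_trans e'e.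
move=> e0 ed.
have h1 : (Qpoly a).[u a - e] < 0 by rewrite (sign_quadratic _ P0 vu QP).1; lra.
have h2 : (Qpoly a).[v a + e] < 0 by rewrite (sign_quadratic _ P0 vu QP).1; lra.
have h3 : 0 < (Qpoly a).[u a + e].
  by rewrite (sign_quadratic _ P0 vu QP).2; apply/orP; right; lra.
have h4 : 0 < (Qpoly a).[v a - e].
  by rewrite (sign_quadratic _ P0 vu QP).2; apply/orP; left; lra.
rewrite near_withinE; near=> b => Ab.
have [vub [_ [P' QP' P'0]]] := hA b Ab.
have : (Qpoly b).[u a - e] < 0 by near: b; exact: near_Qpoly_lt0.
have : (Qpoly b).[v a + e] < 0 by near: b; exact: near_Qpoly_lt0.
have : 0 < (Qpoly b).[u a + e] by near: b; exact: near_Qpoly_gt0.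
have : 0 < (Qpoly b).[v a - e] by near: b; exact: near_Qpoly_gt0.
rewrite !(sign_quadratic _ P'0 vub QP').2 !(sign_quadratic _ P'0 vub QP').1.
move=> /orP k4 /orP k3 /andP[k21 k22] /andP[k11 k12].
rewrite !ltr_norml; split; apply/andP; split; case: k4; case: k3; lra.
Unshelve. all: by end_near. Qed.

End RootContinuity.

(** * Sections over the ratio of two roots *)

Section TwoRootsSection.
Variables (R : realType) (d : nat).
Implicit Types (x w : R).

Lemma horner_homg n w x : (homg n 'X w%:P).[x] = homg n x w.
Proof. by rewrite -/(horner_eval x _) map_homg /= !horner_evalE hornerX hornerC. Qed.

Lemma horner_dgeom n w x : (dgeom n 'X w%:P).[x] = dgeom n x w.
Proof. by rewrite -/(horner_eval x _) map_dgeom /= !horner_evalE hornerX hornerC. Qed.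

Lemma continuous_geom n : continuous (@geom R n).
Proof.
elim: n => [|n IHn] w; first by rewrite (funext (@geom0 R)); exact: cvg_cst.
rewrite (funext (@geomS R n)); apply: cvgD; first exact: IHn.
exact: exprn_continuous.
Qed.

Lemma continuous_coef_homg n i : continuous (fun w : R => (homg n 'X w%:P)`_i).
Proof.
elim: n => [|n IHn] w.
  rewrite (funext (fun w : R => congr1 (coefp i) (homg0 'X w%:P))).
  exact: cvg_cst.
rewrite (_ : (fun w => _) = fun w : R => w * (homg n 'X w%:P)`_i + ('X^n)`_i).
  apply: cvgD; last exact: cvg_cst.
  by apply: cvgM; [exact: cvg_id|exact: IHn].
by apply/funext => z; rewrite homgS coefD coefCM.
Qed.

Lemma continuous_coef_dgeom n i : continuous (fun w : R => (dgeom n 'X w%:P)`_i).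
Proof.
elim: n => [|n IHn] w.
  rewrite (funext (fun w : R => congr1 (coefp i) (dgeom0 'X w%:P))).
  exact: cvg_cst.
rewrite (_ : (fun w => _) =
    fun w : R => (dgeom n 'X w%:P)`_i + (homg n 'X w%:P)`_i).
  by apply: cvgD; [exact: IHn|exact: continuous_coef_homg].
by apply/funext => z; rewrite dgeomS coefD.
Qed.

(** If the polynomial with coefficients a vanishes at 1 and w, the cofactor
    of (X - 1)(X - w) in it: the cofactor of each X^j - 1 would be dgeom j,
    up to the remainders geom j w, which cancel in the sum. *)
Definition dquot w (a : 'rV[R]_d) : {poly R} := \sum_j a 0 j *: dgeom j 'X w%:P.

Lemma dgeom_two_roots n w : (('X - 1) * ('X - w%:P)) * dgeom n 'X w%:P =
  'X^n - 1 - (geom n w)%:P * ('X - 1) :> {poly R}.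
Proof.
by rewrite -mulrA dgeomE mulrBr geomE -(map_geom polyC) [X in _ - X]mulrC.
Qed.

Lemma lowpoly_two_roots (c w : R) (a : 'rV[R]_d) :
  c + \sum_j a 0 j = 0 -> c * geom d w + \sum_j a 0 j * geom j w = 0 ->
  c *: 'X^d + lowpoly a =
  ('X - 1) * ('X - w%:P) * (c *: dgeom d 'X w%:P + dquot w a).
Proof.
move=> s0 g0; rewrite mulrDr -scalerAr dgeom_two_roots big_distrr/=.
under eq_bigr => j _ do rewrite -scalerAr dgeom_two_roots.
have -> : \sum_(j < d) a 0 j *: ('X^j - 1 - (geom j w)%:P * ('X - 1)) =
    lowpoly a - (\sum_j a 0 j)%:P - (\sum_j a 0 j * geom j w)%:P * ('X - 1).
  rewrite !rmorph_sum/= big_distrl/= -!sumrB; apply: eq_bigr => j _.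
  by rewrite !scalerBr polyCM -mulrA -!mul_polyC mulr1.
move/eqP: s0; rewrite addrC addr_eq0 => /eqP ->.
move/eqP: g0; rewrite addrC addr_eq0 => /eqP ->.
rewrite !scalerBr -!mul_polyC !polyCN polyCM; ring.
Qed.

Variables (hd : (0 < d)%N) (sigma : 'I_d -> csign).
Let i0 := Ordinal hd.

(** The constant coefficient is chosen so that the polynomial with leading
    coefficient c vanishes at 1. As geom 0 = dgeom 0 = 0, it enters neither
    the condition for a root at w nor the cofactor of (X - 1)(X - w). *)
Definition pin (c : R) (f : 'I_d -> R) : 'rV[R]_d :=
  \row_j (if j == i0 then - (c + \sum_(i | i != i0) f i) else f j).

Lemma sum_pin c f : c + \sum_j (pin c f) 0 j = 0.
Proof.
rewrite (bigD1 i0)//= mxE eqxx (eq_bigr f) => [|j /negbTE jn]; last by rewrite mxE jn.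
by ring.
Qed.

Lemma sum_pinM c f (g : 'I_d -> R) : g i0 = 0 ->
  \sum_j (pin c f) 0 j * g j = \sum_j f j * g j.
Proof.
move=> g0; apply: eq_bigr => j _; rewrite mxE; case: eqP => // ->.
by rewrite g0 !mulr0.
Qed.

Lemma continuous_pin c (f : R -> 'I_d -> R) j :
  (forall i, continuous (f ^~ i)) -> continuous (fun w => (pin c (f w)) 0 j).
Proof.
move=> cf w; rewrite (_ : (fun z => _) = fun z =>
    if j == i0 then - (c + \sum_(i | i != i0) f z i) else f z j); last first.
  by apply/funext => z; rewrite mxE.
case: eqP => _; last exact: cf.
apply: cvgN; apply: cvgD; first exact: cvg_cst.
by apply: cvg_big => [|i _]; [exact: add_continuous|exact: cf].
Qed.

(** Specialization of [fiber_section] to D = (X - 1)(X - w), with base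
    coefficients f and perturbation g. Only the coefficients of positive
    degree are prescribed. *)
Lemma two_roots_section (B : set R) (f g : R -> 'I_d -> R) : ~~ odd d ->
  (forall w, geom d w + \sum_j f w j * geom j w = 0) ->
  (forall w, \sum_j g w j * geom j w = 0) ->
  (forall w x, B w -> 0 < dgeom d x w + \sum_j f w j * dgeom j x w) ->
  (forall w, B w ->
     0 < csign_val R (sigma i0) * - (1 + \sum_(j | j != i0) f w j)) ->
  (forall j, j != i0 ->
     (forall w, B w -> 0 < csign_val R (sigma j) * f w j) \/
     (forall w, B w -> 0 <= csign_val R (sigma j) * f w j /\
                       0 < csign_val R (sigma j) * g w j)) ->
  (forall j, continuous (f ^~ j)) -> (forall j, continuous (g ^~ j)) ->
  exists s : R -> 'rV[R]_d, forall w, B w ->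
    fiber sigma (('X - 1) * ('X - w%:P)) (s w) /\ s z @[z --> w] --> s w.
Proof.
move=> ed f0 g0 fpos sg0 sgj cf cg.
have X1 : 'X - 1 = 'X - 1%:P :> {poly R} by rewrite polyC1.
have cdq c (h : R -> 'I_d -> R) i : (forall j, continuous (h ^~ j)) ->
    continuous (fun w => (dquot w (pin c (h w)))`_i).
  move=> ch w; rewrite (_ : (fun z => _) = fun z : R =>
      \sum_j (pin c (h z)) 0 j * (dgeom j 'X z%:P)`_i); last first.
    by apply/funext => z; rewrite coef_sum; apply: eq_bigr => j _; rewrite coefZ.
  apply: cvg_big => [|j _]; first exact: add_continuous.
  by apply: cvgM; [exact: continuous_pin|exact: continuous_coef_dgeom].
apply: (@fiber_section R d (d - 2) sigma B
  (fun w => ('X - 1) * ('X - w%:P))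
  (fun w => dgeom d 'X w%:P + dquot w (pin 1 (f w)))
  (fun w => dquot w (pin 0 (g w))) (fun w => pin 1 (f w)) (fun w => pin 0 (g w))).
- exact: leq_subr.
- by rewrite oddB ?(negbTE ed)//; case: (d) hd ed => [|[]].
- by move=> w; rewrite X1 monicMl monicXsubC.
- move=> w; rewrite X1 size_monicM ?monicXsubC ?polyXsubC_eq0// !size_XsubC.
  by case: (d) hd ed => [|[|n]] //= _ _; lia.
- move=> w; rewrite QpolyE -['X^d]scale1r -[dgeom d _ _]scale1r.
  apply: lowpoly_two_roots; first exact: sum_pin.
  by rewrite mul1r sum_pinM//; exact: geom0.
- move=> w; have := @lowpoly_two_roots 0 w (pin 0 (g w)) (sum_pin _ _).
  rewrite !scale0r !add0r mul0r add0r; apply.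
  by rewrite sum_pinM//; exact: geom0.
- move=> w x Bw; rewrite hornerD horner_dgeom horner_sum.
  rewrite (_ : \sum_(i < d) _ = \sum_j f w j * dgeom j x w) ?fpos//.
  rewrite -(@sum_pinM 1 (f w) (fun j => dgeom j x w)); last exact: dgeom0.
  by apply: eq_bigr => j _; rewrite hornerZ horner_dgeom.
- move=> j; have [->|jn] := eqVneq j i0.
    by left => w Bw; rewrite mxE eqxx; exact: sg0.
  by have [h|h] := sgj j jn; [left|right] => w Bw; rewrite !mxE (negbTE jn); exact: h.
- by move=> j; exact: continuous_pin.
- by move=> j; exact: continuous_pin.
- move=> i w; rewrite (_ : (fun z => _) = fun z : R =>
      (dgeom d 'X z%:P)`_i + (dquot z (pin 1 (f z)))`_i); last first.
    by apply/funext => z; rewrite coefD.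
  by apply: cvgD; [exact: continuous_coef_dgeom|exact: cdq].
- by move=> i; exact: cdq.
Qed.

End TwoRootsSection.

Section SignSections.
Variables (R : realType) (d : nat).
Implicit Types (x w : R).
Variables (hd : (0 < d)%N) (sigma : 'I_d -> csign).
Hypothesis ed : ~~ odd d.
Let i0 := Ordinal hd.
Let sg j : R := csign_val R (sigma j).

Lemma csign_sq_gt0 (c : csign) : 0 < csign_val R c * csign_val R c.
Proof. by case: c => /=; rewrite ?mulrNN mulr1. Qed.

Lemma odd_neq_i0 (m : 'I_d) : odd m -> m != i0.
Proof. by move=> om; apply: contraTneq om => ->. Qed.

Lemma continuous_wgeom (I : finType) (P : pred I) (c : I -> R) (n : I -> nat) :
  continuous (fun w : R => \sum_(i | P i) c i * geom (n i) w).
Proof.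
move=> w; apply: cvg_big => [|i _]; first exact: add_continuous.
by apply: cvgM; [exact: cvg_cst|exact: continuous_geom].
Qed.

Lemma continuous_div_geom (h : R -> R) (m : nat) : odd m -> continuous h ->
  continuous (fun w => h w / geom m w).
Proof.
move=> om ch w; apply: cvgM; first exact: ch.
by apply: cvgV; [rewrite gt_eqF// geom_odd_gt0|exact: continuous_geom].
Qed.

(** The base point is the trinomial in 1, x^m, x^d with roots 1 and w. The
    perturbation has the required signs outside 0 and m; its coefficient of
    x^m, where the base point already has the required sign, is adjusted to
    keep the root w. *)
Lemma one_index_section (m : 'I_d) (B : set R) : odd m ->
  (forall w, B w -> w != 0) ->
  (forall w, B w -> 0 < sg m * - geom d w) ->
  (forall w, B w -> 0 < sg i0 * (geom d w - geom m w)) ->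
  exists s : R -> 'rV[R]_d, forall w, B w ->
    fiber sigma (('X - 1) * ('X - w%:P)) (s w) /\ s z @[z --> w] --> s w.
Proof.
move=> om B0 Bm Bi0; have gm w := geom_odd_gt0 w om.
have gm0 w : geom m w != 0 by rewrite gt_eqF.
pose f w j : R := if j == m then - geom d w / geom m w else 0.
pose Z w := \sum_(i | i != m) sg i * geom i w.
pose g w j : R := if j == m then - Z w / geom m w else sg j.
have sumf (h : 'I_d -> R) w : \sum_j f w j * h j = - geom d w / geom m w * h m.
  rewrite (bigD1 m)//= big1 ?addr0 /f ?eqxx// => j /negbTE ->.
  by rewrite mul0r.
apply: (@two_roots_section R d hd sigma B f g ed).
- by move=> w; rewrite sumf mulfVK// subrr.
- move=> w; rewrite (bigD1 m)//= /g eqxx mulfVK// addrC.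
  apply/eqP; rewrite subr_eq0; apply/eqP.
  by apply: eq_bigr => j /negbTE ->.
- move=> w x Bw; rewrite sumf.
  have -> : dgeom d x w + - geom d w / geom m w * dgeom m x w =
      crossg d m x w / geom m w.
    by rewrite /crossg; field; exact: gm0.
  by rewrite divr_gt0// crossg_gt0// B0.
- move=> w Bw; rewrite (bigD1 m) ?odd_neq_i0//= /f eqxx big1 ?addr0; last first.
    by move=> j /andP[_ /negbTE ->].
  have -> : - (1 + - geom d w / geom m w) = (geom d w - geom m w) / geom m w.
    by field; exact: gm0.
  by rewrite mulrA divr_gt0// Bi0.
- move=> j _; have [->|jm] := eqVneq j m.
    by left => w Bw; rewrite /f eqxx mulrA divr_gt0// Bm.
  by right => w Bw; rewrite /f /g (negbTE jm) mulr0 csign_sq_gt0.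
- move=> j; rewrite /f; case: eqP => _; last by move=> w; exact: cvg_cst.
  by apply: continuous_div_geom => // w; apply: cvgN; exact: continuous_geom.
- move=> j; rewrite /g; case: eqP => _; last by move=> w; exact: cvg_cst.
  apply: continuous_div_geom => // w; apply: cvgN; exact: continuous_wgeom.
Qed.

(** The base point is the trinomial in 1, x^m, x^d when geom d w >= 0, i.e. w
    >= -1, and the trinomial in 1, x^k, x^d otherwise; both become x^d - 1 at
    w = -1. As the coefficients of x^m and x^k of the base point vanish
    there, the perturbation has to have the required signs at these two
    indices as well. This is possible because the indices have opposite
    signs: the sum Z of the other terms at w is compensated by its positive
    part at m and by its negative part at k, each increased by 1. *)
Lemma two_index_section (k m : 'I_d) : odd k -> odd m ->
  sigma k = Plus -> sigma m = Minus -> sigma i0 = Minus ->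
  exists s : R -> 'rV[R]_d, forall w, w < 0 ->
    fiber sigma (('X - 1) * ('X - w%:P)) (s w) /\ s z @[z --> w] --> s w.
Proof.
move=> ok om sk sm s0.
have gm w := geom_odd_gt0 w om; have gk w := geom_odd_gt0 w ok.
have gm0 w : geom m w != 0 by rewrite gt_eqF.
have gk0 w : geom k w != 0 by rewrite gt_eqF.
have km : k != m by apply/eqP => e; rewrite e sm in sk.
pose pos (y : R) := Num.max y 0.
have posB y : pos y - pos (- y) = y.
  by rewrite /pos; case: (leP y 0); case: (leP (- y) 0); lra.
have pos_ge0 y : 0 <= pos y by rewrite le_max lexx orbT.
have cpos (h : R -> R) : continuous h -> continuous (fun w => pos (h w)).
  by move=> ch w; apply: (@continuous_max R R h (fun=> 0)); [exact: ch|exact: cvg_cst].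
pose f w j : R := if j == m then - pos (geom d w) / geom m w
  else if j == k then pos (- geom d w) / geom k w else 0.
pose Z w := \sum_(i | (i != m) && (i != k)) sg i * geom i w.
pose g w j : R := if j == m then - (pos (Z w) + 1) / geom m w
  else if j == k then (pos (- Z w) + 1) / geom k w else sg j.
have sumf (h : 'I_d -> R) w : \sum_j f w j * h j =
    - pos (geom d w) / geom m w * h m + pos (- geom d w) / geom k w * h k.
  rewrite (bigD1 m)//= (bigD1 k)//= big1 ?addr0 /f ?eqxx ?(negbTE km)//.
  by move=> j /andP[/negbTE -> /negbTE ->]; rewrite mul0r.
have cZ : continuous Z by exact: continuous_wgeom.
have cN (h : R -> R) : continuous h -> continuous (fun w => - h w).
  by move=> ch w; apply: cvgN; exact: ch.
have c1 (h : R -> R) : continuous h -> continuous (fun w => h w + 1).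
  by move=> ch w; apply: cvgD; [exact: ch|exact: cvg_cst].
have cg : continuous (@geom R d) by exact: continuous_geom.
apply: (@two_roots_section R d hd sigma [set w | w < 0] f g ed).
- by move=> w; rewrite sumf !mulfVK//; have := posB (geom d w); lra.
- move=> w; rewrite (bigD1 m)//= (bigD1 k)//= /g !eqxx (negbTE km) !mulfVK//.
  rewrite (_ : \sum_(i < d | _) _ = Z w).
    by have := posB (Z w); lra.
  by apply: eq_bigr => j /andP[/negbTE -> /negbTE ->].
- move=> w x w0; rewrite sumf.
  have w_neq0 : w != 0 by rewrite lt_eqF.
  have [d0|d0] := leP 0 (geom d w).
    have -> : pos (geom d w) = geom d w by rewrite /pos max_l.
    have -> : pos (- geom d w) = 0 by rewrite /pos max_r// oppr_le0.
    have -> : dgeom d x w + (- geom d w / geom m w * dgeom m x w +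
        0 / geom k w * dgeom k x w) = crossg d m x w / geom m w.
      by rewrite /crossg; field; rewrite gm0 gk0.
    by rewrite divr_gt0// crossg_gt0.
  have -> : pos (geom d w) = 0 by rewrite /pos max_r// ltW.
  have -> : pos (- geom d w) = - geom d w by rewrite /pos max_l// oppr_ge0 ltW.
  have -> : dgeom d x w + (- 0 / geom m w * dgeom m x w +
      - geom d w / geom k w * dgeom k x w) = crossg d k x w / geom k w.
    by rewrite /crossg; field; rewrite gm0 gk0.
  by rewrite divr_gt0// crossg_gt0.
- move=> w w0; rewrite s0 /= mulN1r opprK (bigD1 m) ?odd_neq_i0//=.
  rewrite (bigD1 k) ?odd_neq_i0//= /f !eqxx (negbTE km) big1 ?addr0; last first.
    by move=> j /andP[/andP[_ /negbTE ->] /negbTE ->].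
  have : pos (geom d w) / geom m w < 1.
    by rewrite ltr_pdivrMr// mul1r gt_max gm geom_even_lt_odd.
  have : 0 <= pos (- geom d w) / geom k w by rewrite divr_ge0// ltW.
  by rewrite mulNr; lra.
- move=> j _; right => w w0; have [->|jm] := eqVneq j m.
    rewrite /f /g !eqxx sm /= !mulNr !mul1r !opprK.
    by rewrite divr_ge0 ?divr_gt0// ?(ltW (gm w))// ltr_wpDl.
  have [->|jk] := eqVneq j k.
    rewrite /f /g (negbTE km) !eqxx sk /= !mul1r.
    by rewrite divr_ge0 ?divr_gt0// ?(ltW (gk w))// ltr_wpDl.
  by rewrite /f /g (negbTE jm) (negbTE jk) mulr0 csign_sq_gt0.
- move=> j; rewrite /f; case: eqP => _.
    by apply: continuous_div_geom => //; apply: cN; exact: cpos.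
  case: eqP => _; last by move=> w; exact: cvg_cst.
  by apply: continuous_div_geom => //; apply: cpos; exact: cN.
- move=> j; rewrite /g; case: eqP => _.
    by apply: continuous_div_geom => //; apply/cN/c1; exact: cpos.
  case: eqP => _; last by move=> w; exact: cvg_cst.
  by apply: continuous_div_geom => //; apply/c1/cpos; exact: cN.
Qed.

End SignSections.

(** * Points with at most one real root *)

Section NoRootOneRoot.
Variables (R : realType) (d : nat) (hd : (0 < d)%N) (sigma : 'I_d -> csign).
Let i0 := Ordinal hd.
Let sg j : R := csign_val R (sigma j).

(** The case of [fiber_section] in which nothing depends on w. *)
Lemma fiber_nonempty (n : nat) (D P S : {poly R}) (q t : 'rV[R]_d) :
  (n <= d)%N -> ~~ odd n -> D \is monic -> size D = (d - n).+1 ->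
  Qpoly q = D * P -> lowpoly t = D * S -> (forall x, 0 < P.[x]) ->
  (forall j, 0 < sg j * q 0 j \/ 0 <= sg j * q 0 j /\ 0 < sg j * t 0 j) ->
  exists a, fiber sigma D a.
Proof.
move=> le_nd en mD szD QE TE P0 sgj.
have [|||||||j|j|j|i|i|s hs] := @fiber_section R d n sigma setT (fun=> D) (fun=> P)
  (fun=> S) (fun=> q) (fun=> t) => //; try by move=> w; exact: cvg_cst.
  by have [h|h] := sgj j; [left|right].
by exists (s 0); have [] := hs 0 I.
Qed.

(** A perturbation of x^d + 1. *)
Lemma fiber1_nonempty : ~~ odd d -> sigma i0 = Plus -> exists a : 'rV[R]_d, fiber sigma 1 a.
Proof.
move=> ed s0.
pose q : 'rV[R]_d := \row_j (j == i0)%:R; pose t : 'rV[R]_d := \row_j sg j.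
have QE : Qpoly q = 'X^d + 1.
  rewrite QpolyE; congr (_ + _); rewrite /lowpoly (bigD1 i0)//= mxE eqxx scale1r.
  by rewrite big1 ?addr0// => j /negbTE jn; rewrite mxE jn scale0r.
apply: (@fiber_nonempty d 1 (Qpoly q) (lowpoly t) q t) => //.
- exact: monic1.
- by rewrite size_poly1 subnn.
- by rewrite mul1r.
- by rewrite mul1r.
- move=> x; rewrite QE hornerD hornerXn hornerC ltr_wpDl// exprn_even_ge0//.
- move=> j; right; rewrite !mxE csign_sq_gt0; split=> //.
  by case: eqP => [->|_]; rewrite ?mulr0// /sg s0 mulr1.
Qed.

(** A perturbation of x^d - e with e = 1 or -1, whose only real root is e, of
    sign opposite to the constant coefficient. *)
Lemma fiber_linear_nonempty : odd d ->
  exists a : 'rV[R]_d, fiber sigma ('X - (- sg i0)%:P) a.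
Proof.
move=> od; set e := - sg i0.
have e1 : e = 1 \/ e = -1 by rewrite /e /sg; case: (sigma i0) => /=; rewrite ?opprK; auto.
have ed : e ^+ d = e.
  by case: e1 => ->; rewrite ?expr1n// -signr_odd od expr1.
pose q : 'rV[R]_d := \row_j (if j == i0 then - e else 0).
pose t : 'rV[R]_d := \row_j
  (if j == i0 then - \sum_(i | i != i0) sg i * e ^+ i else sg j).
apply: (@fiber_nonempty d.-1 _ (homg d 'X e%:P)
  (\sum_(j < d) t 0 j *: homg j 'X e%:P) q t) => //.
- exact: leq_pred.
- by case: (d) od => //= ? /negbTE ->.
- exact: monicXsubC.
- by rewrite size_XsubC; case: (d) hd => // n _ /=; rewrite subSnn.
- rewrite QpolyE homgE -polyC_exp ed; congr (_ + _).
  rewrite /lowpoly (bigD1 i0)//= mxE eqxx big1 => [|j /negbTE jn].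
    by rewrite addr0 alg_polyC polyCN.
  by rewrite mxE jn scale0r.
- rewrite big_distrr/=; under [RHS]eq_bigr => j _ do rewrite -scalerAr homgE.
  have -> : \sum_(j < d) t 0 j *: ('X^j - e%:P ^+ j) =
      lowpoly t - (\sum_j t 0 j * e ^+ j)%:P.
    rewrite rmorph_sum/= -sumrB; apply: eq_bigr => j _.
    by rewrite scalerBr -polyC_exp polyCM mul_polyC.
  rewrite (_ : \sum_j _ = 0) ?subr0//.
  rewrite (bigD1 i0)//= mxE eqxx expr0 mulr1 addrC.
  apply/eqP; rewrite subr_eq0; apply/eqP/eq_bigr => j /negbTE jn.
  by rewrite mxE jn.
- move=> x; rewrite horner_homg; have g1 y : homg d y 1 = geom d y.
    by apply: eq_bigr => i _; rewrite expr1n mulr1.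
  case: e1 => ->; first by rewrite g1 geom_odd_gt0.
  rewrite -[x]opprK homgN g1 -signr_odd.
  by case: (d) od => //= n /negbTE on; rewrite on mul1r geom_odd_gt0//= on.
- move=> j; rewrite !mxE; case: eqP => [->|_]; last first.
    by right; rewrite mulr0 csign_sq_gt0.
  by left; rewrite /e opprK csign_sq_gt0.
Qed.

End NoRootOneRoot.

(** * Contractibility for each configuration of the roots *)

Definition neg_sign (c : csign) := if c is Plus then Minus else Plus.

Section Contractibility.
Variables (R : realType) (d : nat).
Implicit Types (a b : 'rV[R]_d) (u v w r : R).

Lemma conv_lt (x y t c : R) : 0 <= t <= 1 -> x < c -> y < c ->
  (1 - t) * x + t * y < c.
Proof.
move=> /andP[t0 t1] xc yc; have [xy|/ltW yx] := leP x y.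
  by apply: le_lt_trans yc; nra.
by apply: le_lt_trans xc; nra.
Qed.

Lemma conv_gt (x y t c : R) : 0 <= t <= 1 -> c < x -> c < y ->
  c < (1 - t) * x + t * y.
Proof.
move=> t01 xc yc; rewrite -ltrN2 opprD -!mulrN.
by apply: conv_lt; rewrite ?ltrN2.
Qed.

Lemma XsubC_rescale r u : r != 0 ->
  ('X - u%:P) \Po (r^-1 *: 'X) = r^-1 *: ('X - (r * u)%:P) :> {poly R}.
Proof.
move=> r0; rewrite comp_polyB comp_polyX comp_polyC scalerBr; congr (_ - _).
by rewrite -mul_polyC -polyCM mulKf.
Qed.

Section SignPattern.
Variables (hd : (0 < d)%N) (sigma : 'I_d -> csign).
Let i0 := Ordinal hd.
Let sg j : R := csign_val R (sigma j).

Lemma Qpoly_at0 a : (Qpoly a).[0] = a 0 i0.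
Proof.
rewrite horner_Qpoly (bigD1 i0)//= expr0 mulr1 expr0n eqn0Ngt hd add0r.
by rewrite big1 ?addr0// => j j0; rewrite expr0n (negbTE (_ : j != 0%N :> nat)) ?mulr0.
Qed.

Lemma Eset_contractible a0 : fiber sigma 1 a0 -> contractible R (@Eset R d sigma).
Proof.
move=> fa0; rewrite EsetE.
apply: (@contractible_fibration R d _ (fun=> fiber sigma 1) [set 0] 0
  (fun=> 1) (fun=> 0) (fun=> a0)) => //.
- by move=> x y t _ -> ->; rewrite !mulr0 addr0.
- by move=> _ a b t; exact: fiber_conv.
- by move=> a fa; rewrite invr1 rescale1.
- move=> _ b rho _ rho0; apply: (@fiber_rescale _ _ _ _ 1) => //.
  by rewrite -[X in X \Po _]polyC1 comp_polyC scale1r.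
- by move=> a _; exact: cvg_cst.
- by move=> a _; exact: cvg_cst.
- by move=> x _; split=> //; exact: cvg_cst.
Qed.

(** The root u has the sign of e, so e * u is its absolute value, and
    rescaling by it brings the root to e. The parameter w is absent: B is a
    point. *)
Lemma Fset_contractible a0 : fiber sigma ('X - (- sg i0)%:P) a0 ->
  contractible R (@Fset R d sigma).
Proof.
set e := - sg i0 => fa0.
have e2 : e * e = 1.
  by rewrite /e /sg; case: (sigma i0) => /=; rewrite ?opprK ?mulrNN mulr1.
have /choice[u hu] : forall a, exists u : R,
    Fset sigma a -> fiber sigma ('X - u%:P) a.
  move=> a; have [/FsetP[u fu]|nF] := pselect (Fset sigma a); first by exists u.
  by exists 0 => /nF.
have eu a : Fset sigma a -> 0 < e * u a.
  move=> /hu[/has_signsP/(_ i0) sa [P QP P0]].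
  move: sa; rewrite -Qpoly_at0 QP hornerM hornerXsubC sub0r mulrA pmulr_lgt0//.
  by rewrite mulrN -mulNr.
apply: (@contractible_fibration R d _ (fun=> fiber sigma ('X - e%:P)) [set 0] 0
  (fun a => e * u a) (fun=> 0) (fun=> a0)) => //.
- by move=> x y t _ -> ->; rewrite !mulr0 addr0.
- by move=> _ a b t; exact: fiber_conv.
- move=> a Fa; split=> //; first exact: eu.
  have r0 := eu a Fa.
  apply: (@fiber_rescale _ _ _ _ (e * u a) _ _ _ _ _ _ (hu a Fa)) => //.
    by rewrite invr_gt0.
  rewrite XsubC_rescale ?invr_eq0 ?gt_eqF// invrK; congr (_ *: ('X - _%:P)).
  have u0 : u a != 0 by apply: contraTneq r0 => ->; rewrite mulr0 ltxx.
  have e0 : e != 0 by apply: contraTneq r0 => ->; rewrite mul0r ltxx.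
  by rewrite invfM -mulrA mulVf// mulr1 -[RHS]mul1r -(mulVf e0) -mulrA e2 mulr1.
- move=> _ b rho _ rho0 fb; apply/FsetP; exists (rho * e).
  apply: (@fiber_rescale _ _ _ _ rho^-1 _ _ _ rho0 _ _ fb); first by rewrite invr_gt0.
  by rewrite XsubC_rescale// gt_eqF.
- move=> a Fa; apply: cvgM; first exact: cvg_cst.
  exact: (cvg_simple_root hu Fa).
- by move=> a _; exact: cvg_cst.
- by move=> x _; split=> //; exact: cvg_cst.
Qed.

(** Rescaling by the larger root u leaves the ratio v / u as the parameter. *)
Lemma two_roots_contractible (A : set 'rV[R]_d) (B : set R) (w0 : R)
    (s : R -> 'rV[R]_d) :
  (forall a, A a -> exists uv : R * R, [/\ 0 < uv.1, uv.2 < uv.1, B (uv.2 / uv.1) &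
     fiber sigma (('X - uv.1%:P) * ('X - uv.2%:P)) a]) ->
  (forall w b r, B w -> 0 < r ->
     fiber sigma (('X - r%:P) * ('X - (r * w)%:P)) b -> A b) ->
  B w0 ->
  (forall x y (t : R), 0 <= t <= 1 -> B x -> B y -> B ((1 - t) * x + t * y)) ->
  (forall w, B w -> fiber sigma (('X - 1) * ('X - w%:P)) (s w) /\
                    s z @[z --> w] --> s w) ->
  contractible R A.
Proof.
move=> hA hB Bw0 Bconv hs.
have /choice[uv huv] : forall a, exists uv : R * R, A a ->
    [/\ 0 < uv.1, uv.2 < uv.1, B (uv.2 / uv.1) &
     fiber sigma (('X - uv.1%:P) * ('X - uv.2%:P)) a].
  move=> a; have [/hA[uv huv]|nA] := pselect (A a); first by exists uv.
  by exists (0, 0) => /nA.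
have cuv := @cvg_two_roots R d sigma A (fun a => (uv a).1) (fun a => (uv a).2)
  (fun a Aa => let: And4 _ h2 _ h4 := huv a Aa in conj h2 h4).
apply: (@contractible_fibration R d A
  (fun w => fiber sigma (('X - 1) * ('X - w%:P))) B w0
  (fun a => (uv a).1) (fun a => (uv a).2 / (uv a).1) s) => //.
- by move=> x a b t; exact: fiber_conv.
- move=> a Aa; have [u0 vu Bw fa] := huv a Aa; split=> //.
  apply: (@fiber_rescale _ _ _ _ ((uv a).1 * (uv a).1) _ _ _ _ _ _ fa).
  + by rewrite invr_gt0.
  + exact: mulr_gt0.
  rewrite comp_polyM !XsubC_rescale ?invr_eq0 ?gt_eqF// invrK.
  rewrite -scalerAl -scalerAr scalerA mulVf ?gt_eqF// polyC1.
  by rewrite [_^-1 * (uv a).2]mulrC.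
- move=> w b r Bw r0 fb; apply: (hB w _ r) => //.
  apply: (@fiber_rescale _ _ _ _ (r^-1 * r^-1) _ _ _ r0 _ _ fb).
    by rewrite mulr_gt0 ?invr_gt0.
  rewrite comp_polyM -polyC1 !XsubC_rescale ?gt_eqF// mulr1.
  by rewrite -scalerAl -scalerAr scalerA.
- by move=> a Aa; have [] := cuv a Aa.
- move=> a Aa; have [cu cv] := cuv a Aa; have [u0 _ _ _] := huv a Aa.
  by apply: (cvgM cv); apply: cvgV; rewrite ?gt_eqF.
Qed.

Hypothesis ed : ~~ odd d.

Lemma QpolyB_opp a x : (Qpoly a).[x] - (Qpoly a).[- x] =
  2 * \sum_(j < d | odd j) a 0 j * x ^+ j.
Proof.
rewrite !horner_Qpoly [(- x) ^+ d]exprNn -signr_odd (negbTE ed) mul1r.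
rewrite opprD addrACA subrr add0r -sumrB big_distrr/= [RHS]big_mkcond/=.
apply: eq_bigr => j _; rewrite [(- x) ^+ j]exprNn -signr_odd.
by case: (odd j); rewrite ?expr1 ?expr0; ring.
Qed.

Let lt1d : (1 < d)%N.
Proof. by case: (d) hd ed => [|[]]. Qed.
Let i1 := Ordinal lt1d.

Lemma odd_part_gt0 (c : csign) a x : has_signs sigma a -> 0 < x ->
  (forall j : 'I_d, odd j -> sigma j = c) ->
  0 < csign_val R c * ((Qpoly a).[x] - (Qpoly a).[- x]).
Proof.
move=> /has_signsP sa x0 sc; rewrite QpolyB_opp mulrCA mulr_gt0// big_distrr/=.
have pos (j : 'I_d) : odd j -> 0 < csign_val R c * (a 0 j * x ^+ j).
  by move=> oj; rewrite mulrA mulr_gt0 ?exprn_gt0// -(sc j oj).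
have o1 : odd i1 by [].
rewrite (bigD1 i1)//= ltr_pwDl//; first exact: pos o1.
by apply: sumr_ge0 => j /andP[oj _]; rewrite ltW// pos.
Qed.

(** The odd part is positive at u, so Q(-u) < Q(u) = 0 and -u lies between
    the two roots. *)
Lemma odd_plus_roots a u v : (forall j : 'I_d, odd j -> sigma j = Plus) ->
  0 < u -> v < u -> fiber sigma (('X - u%:P) * ('X - v%:P)) a -> v < - u.
Proof.
move=> sp u0 vu [sa [P QP P0]]; have := odd_part_gt0 sa u0 sp.
have -> : (Qpoly a).[u] = 0 by rewrite QP !hornerM hornerXsubC subrr !mul0r.
rewrite mul1r sub0r oppr_gt0 (sign_quadratic _ P0 vu QP).1.
by case/andP.
Qed.

(** The odd part is negative at u, so Q(-u) > Q(u) = 0 and -u lies to the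
    left of both roots. *)
Lemma odd_minus_roots a u v : (forall j : 'I_d, odd j -> sigma j = Minus) ->
  0 < u -> v < u -> fiber sigma (('X - u%:P) * ('X - v%:P)) a -> - u < v.
Proof.
move=> sp u0 vu [sa [P QP P0]]; have := odd_part_gt0 sa u0 sp.
have -> : (Qpoly a).[u] = 0 by rewrite QP !hornerM hornerXsubC subrr !mul0r.
rewrite mulN1r sub0r opprK (sign_quadratic _ P0 vu QP).2.
by case/orP => //; lra.
Qed.

Lemma fiber_two_roots_at0 a u v :
  fiber sigma (('X - u%:P) * ('X - v%:P)) a -> 0 < sg i0 * (u * v).
Proof.
move=> [/has_signsP/(_ i0) sa [P QP P0]]; move: sa.
by rewrite -Qpoly_at0 QP !hornerM !hornerXsubC !sub0r mulrNN !mulrA pmulr_lgt0.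
Qed.

Lemma geom_even_gt0 w : -1 < w -> 0 < geom d w.
Proof.
move=> w1; have [w0|w0] := leP 0 w; first by rewrite (lt_le_trans ltr01)// geom_ge1.
have : (w - 1) * geom d w < 0.
  rewrite geomE subr_lt0 -[w]opprK exprNn -signr_odd (negbTE ed) mul1r.
  by rewrite exprn_ilt1 -?lt0n//; lra.
by rewrite nmulr_rlt0//; lra.
Qed.

Lemma geom_even_lt0 w : w < -1 -> geom d w < 0.
Proof.
move=> w1; have : 0 < (w - 1) * geom d w.
  rewrite geomE subr_gt0 -[w]opprK exprNn -signr_odd (negbTE ed) mul1r.
  by rewrite exprn_egt1 -?lt0n//; lra.
by rewrite nmulr_rgt0//; lra.
Qed.

Lemma odd_signs_dichotomy (c : csign) :
  (forall j : 'I_d, odd j -> sigma j = c) \/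
  exists2 j : 'I_d, odd j & sigma j = neg_sign c.
Proof.
have [|nh] := pselect (forall j : 'I_d, odd j -> sigma j = c); first by left.
right; apply: contrapT => h; apply: nh => j oj; apply: contrapT => sj.
by apply: h; exists j => //; move: sj; case: (c); case: (sigma j).
Qed.

(** The range of the ratio of the roots is ]-1, 0[, ]-oo, -1[ or ]-oo, 0[
    according to the signs which occur among the odd coefficients. *)
Lemma Gset11_contractible : sigma i0 = Minus -> contractible R (@Gset11 R d sigma).
Proof.
move=> s0.
have split_roots a : Gset sigma a -> exists uv : R * R,
    [/\ 0 < uv.1, uv.2 < 0 & fiber sigma (('X - uv.1%:P) * ('X - uv.2%:P)) a].
  move=> /GsetP[[u v] /= vu fa]; exists (u, v) => /=.
  have := fiber_two_roots_at0 fa; rewrite /sg s0 mulN1r oppr_gt0.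
  have [v0|v0|v0] := ltgtP v 0.
  - by rewrite nmulr_llt0.
  - by rewrite pmulr_llt0// => u0; have := lt_trans v0 (lt_trans vu u0); rewrite ltxx.
  - by rewrite v0 mulr0 ltxx.
have join_roots w b r : w < 0 -> 0 < r ->
    fiber sigma (('X - r%:P) * ('X - (r * w)%:P)) b -> Gset sigma b.
  move=> w0 r0 fb; apply/GsetP; exists (r, r * w) => //=.
  by rewrite (lt_trans _ r0)// pmulr_rlt0.
have [om|[k ok sk]] := odd_signs_dichotomy Minus.
- have sp1 (j : 'I_d) : odd j -> csign_val R (sigma j) = -1 by move=> /om ->.
  have [||||s hs] := @one_index_section R d hd sigma ed i1 [set w | -1 < w < 0] => //.
  + by move=> w /= /andP[_ w0]; rewrite lt_eqF.
  + move=> w /= /andP[w1 _]; rewrite sp1// mulN1r opprK; exact: geom_even_gt0.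
  + move=> w /= /andP[_ w0]; rewrite s0 mulN1r opprB subr_gt0.
    exact: geom_even_lt_odd.
  apply: (@two_roots_contractible _ [set w | -1 < w < 0] (- 2^-1) s) => //.
  + move=> a /split_roots[[u v] /= [u0 v0 fa]]; exists (u, v); split=> //=.
      exact: lt_trans u0.
    rewrite ltr_pdivlMr// mulN1r ltr_pdivrMr// mul0r v0 andbT.
    by apply: (odd_minus_roots om u0 _ fa); exact: lt_trans u0.
  + by move=> w b r /andP[_ w0]; exact: join_roots.
  + by rewrite /= ltrN2 invf_lt1 ?ltr1n// oppr_lt0 invr_gt0 ltr0n.
  + move=> x y t t01 /= /andP[x1 x0] /andP[y1 y0].
    by rewrite conv_gt// conv_lt.
have [op|[m omd sm]] := odd_signs_dichotomy Plus.
- have sp1 (j : 'I_d) : odd j -> csign_val R (sigma j) = 1 by move=> /op ->.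
  have [||||s hs] := @one_index_section R d hd sigma ed i1 [set w | w < -1] => //.
  + by move=> w /= w1; rewrite lt_eqF// (lt_trans w1)// oppr_lt0.
  + move=> w /= w1; rewrite sp1// mul1r oppr_gt0; exact: geom_even_lt0.
  + move=> w /= w1; rewrite s0 mulN1r opprB subr_gt0.
    by apply: geom_even_lt_odd => //; rewrite (lt_trans w1)// oppr_lt0.
  apply: (@two_roots_contractible _ [set w | w < -1] (- 2) s) => //.
  + move=> a /split_roots[[u v] /= [u0 v0 fa]]; exists (u, v); split=> //=.
      exact: lt_trans u0.
    rewrite ltr_pdivrMr// mulN1r.
    by apply: (odd_plus_roots op u0 _ fa); exact: lt_trans u0.
  + by move=> w b r /= w1; apply: join_roots; rewrite (lt_trans w1)// oppr_lt0.
  + by rewrite /= ltrN2 ltr1n.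
  + by move=> x y t t01 /= x1 y1; exact: conv_lt.
have [s hs] := @two_index_section R d hd sigma ed k m ok omd sk sm s0.
apply: (@two_roots_contractible _ [set w | w < 0] (- 1) s) => //.
- move=> a /split_roots[[u v] /= [u0 v0 fa]]; exists (u, v); split=> //=.
    exact: lt_trans u0.
  by rewrite ltr_pdivrMr// mul0r.
- by rewrite /= oppr_lt0.
- by move=> x y t t01 /= x1 y1; exact: conv_lt.
Qed.

Lemma Gset20P a : @Gset20 R d sigma a <-> exists uv : R * R,
  [/\ 0 < uv.2, uv.2 < uv.1 & fiber sigma (('X - uv.1%:P) * ('X - uv.2%:P)) a].
Proof.
split=> [[/GsetP[[u v] /= vu fa] pos]|[[u v] /= [v0 vu fa]]].
  exists (u, v); split=> //=; apply: pos; have [_ [P -> _]] := fa.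
  by rewrite !rootM !root_XsubC eqxx orbT.
split; first by apply/GsetP; exists (u, v).
move=> z; have [_ [P -> P0]] := fa; rewrite !rootM !root_XsubC.
have -> : root P z = false by rewrite rootE gt_eqF.
rewrite orbF => /orP[]/eqP -> //; exact: lt_trans vu.
Qed.

(** Otherwise the smaller root would be less than -u < 0. *)
Lemma Gset20_odd_plus : (forall j : 'I_d, odd j -> sigma j = Plus) ->
  @Gset20 R d sigma = set0.
Proof.
move=> sp; apply/seteqP; split=> // a /Gset20P[[u v] /= [v0 vu fa]].
have := odd_plus_roots sp (lt_trans v0 vu) vu fa.
by rewrite ltNge ltW// (lt_trans _ v0)// oppr_lt0 (lt_trans v0).
Qed.

Lemma Gset20_contractible (m : 'I_d) : sigma i0 = Plus -> odd m ->
  sigma m = Minus -> contractible R (@Gset20 R d sigma).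
Proof.
move=> s0 om sm.
have [||||s hs] := @one_index_section R d hd sigma ed m [set w | 0 < w < 1] => //.
- by move=> w /= /andP[w0 _]; rewrite gt_eqF.
- move=> w /= /andP[w0 _]; rewrite sm /= mulN1r opprK.
  by apply: geom_even_gt0; rewrite (lt_trans _ w0)// oppr_lt0.
- move=> w /= /andP[w0 _]; rewrite s0 mul1r subr_gt0; exact: lt_geom.
apply: (@two_roots_contractible _ [set w | 0 < w < 1] 2^-1 s) => //.
- move=> a /Gset20P[[u v] /= [v0 vu fa]]; have u0 := lt_trans v0 vu.
  by exists (u, v); split=> //=; rewrite divr_gt0//= ltr_pdivrMr// mul1r.
- move=> w b r /= /andP[w0 w1] r0 fb; apply/Gset20P; exists (r, r * w).
  by split=> //=; [exact: mulr_gt0|rewrite gtr_pMr].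
- by rewrite /= invr_gt0 ltr0n invf_lt1 ?ltr1n.
- move=> x y t t01 /= /andP[x0 x1] /andP[y0 y1].
  by rewrite conv_gt// conv_lt.
Qed.

Lemma Gset20_dichotomy : sigma i0 = Plus ->
  (contractible R (@Gset20 R d sigma) \/ @Gset20 R d sigma = set0) /\
  (@Gset20 R d sigma = set0 <-> forall j : 'I_d, odd j -> sigma j = Plus).
Proof.
move=> s0; have [sp|[m om sm]] := odd_signs_dichotomy Plus.
  have G0 := Gset20_odd_plus sp; split; [by right|by split].
have cG := Gset20_contractible s0 om sm; split; first by left.
split=> [G0|/(_ m om)]; last by rewrite sm.
by have [a [+ _]] := cG; rewrite G0.
Qed.

End SignPattern.
End Contractibility.

(** * Reflection and the cases of emptiness *)

Section Reflection.
Variables (R : realType).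

Lemma contractible_preimage (T : topologicalType) (f : T -> T) (A : set T) :
  continuous f -> involutive f -> contractible R A -> contractible R (f @^-1` A).
Proof.
move=> cf fK [x0 [Ax0 [H [cH AH H0 H1]]]].
exists (f x0); split; first by rewrite /preimage /= fK.
exists (fun p => f (H (f p.1, p.2))); split.
- apply/subspace_continuousP => -[x t] [/= Ax t01].
  move/subspace_continuousP : cH => /(_ (f x, t) (conj Ax t01)) cH.
  apply: (cvg_comp (fun p : T * R => H (f p.1, p.2)) f _ (cf _)).
  apply: (cvg_comp (fun p : T * R => (f p.1, p.2)) H _ cH).
  have cft : (f p.1, p.2) @[p --> (x, t)] --> (f x, t).
    have c2 : p.2 @[p --> (x, t)] --> t by exact: cvg_snd.
    have c1 : p.1 @[p --> (x, t)] --> x by exact: cvg_fst.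
    exact: (cvg_pair (cvg_comp _ f c1 (cf x)) c2).
  move=> U AU; apply: (@filterS _ (nbhs (x, t)) _ _ _ _ (cft _ AU)).
  by move=> p /= h [Ap tp]; apply: h.
- by move=> x t Ax t01; rewrite /preimage /= fK; exact: AH.
- by move=> x Ax /=; rewrite H0// fK.
- by move=> x Ax /=; rewrite H1.
Qed.

Variable d : nat.
Hypothesis ed : ~~ odd d.

Definition reflect (a : 'rV[R]_d) : 'rV[R]_d := \row_j ((-1) ^+ j * a 0 j).

Definition flip (sigma : 'I_d -> csign) (j : 'I_d) : csign :=
  if odd j then neg_sign (sigma j) else sigma j.

Lemma reflectK : involutive reflect.
Proof.
by move=> a; apply/rowP => j; rewrite !mxE mulrA -exprMn mulrNN mulr1 expr1n mul1r.
Qed.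

Lemma flipK : involutive flip.
Proof.
move=> sigma; apply/funext => j; rewrite /flip; case: (odd j) => //.
by case: (sigma j).
Qed.

Lemma continuous_reflect : continuous reflect.
Proof.
move=> a; have FF : Filter (nbhs a) by exact: nbhs_filter.
apply: (@cvg_rV R d _ (nbhs a) reflect (reflect a)) => j; rewrite mxE.
rewrite (_ : (fun z => _) = fun z : 'rV[R]_d => (-1) ^+ j * z 0 j); last first.
  by apply/funext => z; rewrite mxE.
by apply: cvgM; [exact: cvg_cst|exact: coord_continuous].
Qed.

Lemma Qpoly_reflect (a : 'rV[R]_d) x : (Qpoly (reflect a)).[x] = (Qpoly a).[- x].
Proof.
rewrite !horner_Qpoly [(- x) ^+ d]exprNn -signr_odd (negbTE ed) mul1r.
congr (_ + _); apply: eq_bigr => j _; rewrite mxE [(- x) ^+ j]exprNn; ring.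
Qed.

Lemma Gset_reflect sigma (a : 'rV[R]_d) :
  Gset sigma a -> Gset (flip sigma) (reflect a).
Proof.
move=> /GsetP[[u v] /= vu [/has_signsP sa [P QP P0]]].
apply/GsetP; exists (- v, - u) => /=; first by rewrite ltrN2.
split.
  apply/has_signsP => j; move: (sa j); rewrite mxE /flip -signr_odd.
  case: (odd j); rewrite ?mul1r// expr1 mulN1r mulrN -mulNr.
  by case: (sigma j) => /=; rewrite ?opprK.
have QE : Qpoly (reflect a) = Qpoly a \Po (- 'X).
  rewrite !QpolyE /lowpoly comp_polyD comp_Xn_poly exprNn -signr_odd (negbTE ed) mul1r.
  congr (_ + _); rewrite rmorph_sum/=; apply: eq_bigr => j _.
  rewrite comp_polyZ comp_Xn_poly mxE [(- 'X) ^+ j]exprNn.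
  rewrite mulrC -scalerA -!(signr_odd _ j).
  by case: (odd j); rewrite ?expr1 ?expr0 ?scaleN1r ?mulN1r ?scale1r ?mul1r.
exists (P \Po (- 'X)); last by move=> x; rewrite horner_comp.
rewrite QE QP !comp_polyM !comp_polyB !comp_polyX !comp_polyC !polyCN; ring.
Qed.

Lemma Gset02E sigma : @Gset02 R d sigma = reflect @^-1` @Gset20 R d (flip sigma).
Proof.
apply/seteqP; split=> a [Ga rz]; split.
- exact: Gset_reflect.
- by move=> z; rewrite rootE Qpoly_reflect -rootE => /rz; rewrite oppr_lt0.
- by rewrite -(flipK sigma) -(reflectK a); exact: Gset_reflect.
- move=> z rtz; rewrite -oppr_gt0; apply: rz.
  by rewrite rootE Qpoly_reflect opprK -rootE.
Qed.

End Reflection.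

(** The two alternatives are distinguished by the presence of a negative
    coefficient of even degree. *)
Lemma case1E d (hd : (0 < d)%N) (sigma : 'I_d -> csign) :
  sigma (Ordinal hd) = Plus ->
  (case1 sigma \/ no_sign_change sigma) <->
  forall j : 'I_d, odd j -> sigma j = Plus.
Proof.
move=> s0; split=> [[[]//|h j _]|sp]; first exact: h.
have s00 (j : 'I_d) : j = 0%N :> nat -> sigma j = Plus.
  by move=> j0; rewrite -s0; congr sigma; exact: val_inj.
have [ex|nex] := pselect (exists j : 'I_d, ~~ odd j /\ sigma j = Minus).
  by left.
right => j; case sj : (sigma j) => //; have [oj|ej] := boolP (odd j).
  by rewrite -sj sp.
by case: nex; exists j.
Qed.

Lemma case2E d (hd : (0 < d)%N) (sigma : 'I_d -> csign) :
  sigma (Ordinal hd) = Plus ->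
  (case2 sigma \/ no_sign_preservation sigma) <->
  forall j : 'I_d, odd j -> sigma j = Minus.
Proof.
move=> s0; split=> [[[]//|h j oj]|sm]; first by rewrite h oj.
have s00 (j : 'I_d) : j = 0%N :> nat -> sigma j = Plus.
  by move=> j0; rewrite -s0; congr sigma; exact: val_inj.
have [ex|nex] := pselect (exists j : 'I_d, ~~ odd j /\ sigma j = Minus).
  by left.
right => j; have [oj|ej] := boolP (odd j); first exact: sm.
by case sj : (sigma j) => //; case: nex; exists j.
Qed.

Theorem theorem1 (R : realType) (d : nat) (hd : (0 < d)%N) :
  [/\ (* (1) *)
      (~~ odd d -> forall sigma : 'I_d -> csign,
         sigma (Ordinal hd) = Plus ->
         [/\ @Eset R d sigma !=set0,
             @convex_set R 'rV[R]_d (@Eset R d sigma) &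
             contractible R (@Eset R d sigma)]),
      (* (2) *)
      (odd d -> forall sigma : 'I_d -> csign,
         @Fset R d sigma !=set0 /\ contractible R (@Fset R d sigma)),
      (* (3), negative constant term *)
      (~~ odd d -> forall sigma : 'I_d -> csign,
         sigma (Ordinal hd) = Minus ->
         contractible R (@Gset11 R d sigma)) &
      (* (3), positive constant term *)
      (~~ odd d -> forall sigma : 'I_d -> csign,
         sigma (Ordinal hd) = Plus ->
         [/\ contractible R (@Gset20 R d sigma) \/ @Gset20 R d sigma = set0,
             @Gset20 R d sigma = set0 <->
               case1 sigma \/ no_sign_change sigma,
             contractible R (@Gset02 R d sigma) \/ @Gset02 R d sigma = set0 &
             @Gset02 R d sigma = set0 <->
               case2 sigma \/ no_sign_preservation sigma])].
Proof.
split.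
- move=> ed sigma s0; have [a0 fa0] := @fiber1_nonempty R d hd sigma ed s0.
  split; last exact: Eset_contractible fa0.
    by exists a0; rewrite EsetE.
  rewrite EsetE => a b t; rewrite !inE => fa fb.
  have -> : conv t a b = (1 - t%:num) *: b + t%:num *: a by rewrite addrC.
  by apply: fiber_conv => //; rewrite ge0 le1.
- move=> od sigma; have [a0 fa0] := @fiber_linear_nonempty R d hd sigma od.
  split; last exact: Fset_contractible fa0.
  by exists a0; apply/FsetP; eexists; exact: fa0.
- by move=> ed sigma s0; exact: Gset11_contractible s0.
- move=> ed sigma s0.
  have f0 : flip sigma (Ordinal hd) = Plus by [].
  have [c20 e20] := Gset20_dichotomy R ed s0.
  have [c02 e02] := Gset20_dichotomy R ed f0.
  split=> //.
  + by rewrite e20 (case1E s0).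
  + rewrite Gset02E//; case: c02 => [c02|->]; last by right; rewrite preimage_set0.
    left; apply: contractible_preimage c02; first exact: continuous_reflect.
    exact: reflectK.
  + rewrite (case2E s0) Gset02E//; transitivity (@Gset20 R d (flip sigma) = set0).
      split=> [h|->]; last by rewrite preimage_set0.
      apply/seteqP; split=> // a Ga.
      have : (@reflect R d @^-1` @Gset20 R d (flip sigma)) (reflect a).
        by rewrite /preimage /= reflectK.
      by rewrite h.
    rewrite e02; split=> h j oj; move: (h j oj); rewrite /flip oj.
      by case: (sigma j).
    by move=> ->.
Qed.
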